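(* Let $c>0$, $\bar v_1^+>0$, let $\epsilon_0>0$ be a small fixed number, and assume $\epsilon_0\le M:=\bar v_1^+/c<\sqrt2$. Then the linear problem $$\begin{cases}\partial_t h+\bar v_1\partial_1 h+\operatorname{div}v=0&\text{in }\Omega,\\ \partial_t v+\bar v_1\partial_1 v+c^2\nabla h=0&\text{in }\Omega,\\ \partial_t f=v_2-\bar v_1\partial_1 f&\text{on }\Gamma,\end{cases}$$ with the jump boundary conditions $$[h]=0,\qquad [v\cdot e_2]=2\bar v_1^+\partial_1 f\qquad\text{on }\Gamma,$$ is ill-posed in the sense of Hadamard in $H^k(\Omega)$ for every $k$. More precisely, for any $k,j\in\mathbb N$ with $j\ge k$ and any $T_0>0$, $\alpha>0$, there exists a sequence $\{(f_n,v_n,h_n)\}_{n=1}^\infty$ of solutions of the linear problem, satisfying the jump boundary conditions, such that $$\|(f_n(0),h_n(0),v_n(0))\|_{H^j}\lesssim\frac1n ,$$ but $$\|(f_n,h_n,v_n)(t)\|_{H^k}\ge\alpha\qquad\text{for all }t\ge T_0 .$$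
   Context: $\Omega^{+}=\{x\in\mathbb R^2:x_2>0\}$, $\Omega^-=\{x\in\mathbb R^2:x_2<0\}$, $\Gamma=\{x_2=0\}$; an equation ''in $\Omega$'' holds in both $\Omega^+$ and $\Omega^-$. The unknowns are $f(t,x_1)$ (scalar) on $\Gamma$, and $h(t,x)$ (scalar), $v(t,x)=(v_1,v_2)$ on $\Omega$, where functions on $\Omega$ are pairs with components on $\Omega^\pm$ denoted by superscripts $\pm$. The constant $\bar v_1$ equals $\bar v_1^+$ in $\Omega^+$ and $\bar v_1^-=-\bar v_1^+$ in $\Omega^-$; the equation for $f$ on $\Gamma$ holds with the traces from both sides. $c$ is the constant sound speed of the background state, $e_2=(0,1)$, and $[g]=g^+|_\Gamma-g^-|_\Gamma$. Norms: with $\hat\psi(\eta,x_2)=\int_{\mathbb R}\psi(x_1,x_2)e^{-ix_1\eta}dx_1$, $I_+=(0,\infty)$, $I_-=(-\infty,0)$, $$\|\psi\|_{H^j(\Omega^\pm)}^2=\sum_{s=0}^j\int_{\mathbb R}(1+\eta^2)^{j-s}\|\partial_2^s\hat\psi_\pm(\eta,\cdot)\|_{L^2(I_\pm)}^2d\eta,\qquad \|\psi\|_{H^j(\Omega)}^2=\|\psi^+\|_{H^j(\Omega^+)}^2+\|\psi^-\|_{H^j(\Omega^-)}^2,$$ $\|f\|_{H^j(\Gamma)}^2=\int_{\mathbb R}(1+\eta^2)^j|\hat f(\eta)|^2d\eta$, and $\|(f,h,v)\|_{H^j}=\|f\|_{H^j(\Gamma)}+\|h\|_{H^j(\Omega)}+\|v\|_{H^j(\Omega)}$.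 $a\lesssim b$ means $a\le Cb$ with a constant $C>0$ that may depend on the parameters of the problem but not on the data; in particular $C$ is independent of $n$. *)

(* Defs.v *)
From HB Require Import structures.
From mathcomp Require Import all_boot all_order all_algebra.
From mathcomp Require Import all_classical all_reals all_analysis.

Set Implicit Arguments.
Unset Strict Implicit.
Unset Printing Implicit Defensive.

Import Order.TTheory GRing.Theory Num.Theory.
Import numFieldNormedType.Exports.

Local Open Scope classical_set_scope.
Local Open Scope ring_scope.

(* A function on Omega is a family psi : side -> ... of its two components. *)
Variant side := Plus | Minus.

Section VortexSheet.
Variable R : realType.
Implicit Types (s : side) (j k : nat) (t eta c vbar : R).

Definition halfline s : set R :=
  match s with Plus => `]0, +oo[ | Minus => `]-oo, 0[ end.

Definition halfline_closed s : set R :=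
  match s with Plus => `[0, +oo[ | Minus => `]-oo, 0] end.

(* Real and imaginary parts of the integral of g(y) exp(- i y eta). *)
Definition fourier_re (g : R -> R) eta : R :=
  \int[lebesgue_measure]_y (g y * cos (y * eta)).

Definition fourier_im (g : R -> R) eta : R :=
  - \int[lebesgue_measure]_y (g y * sin (y * eta)).

(* psi-hat as a function of x2, at a fixed frequency eta. *)
Definition hat_re (psi : R -> R -> R) eta (x2 : R) : R :=
  fourier_re (psi ^~ x2) eta.

Definition hat_im (psi : R -> R -> R) eta (x2 : R) : R :=
  fourier_im (psi ^~ x2) eta.

Definition sqnorm_Gamma j (f : R -> R) : \bar R :=
  (\int[lebesgue_measure]_eta
     ((1 + eta ^+ 2) ^+ j
      * (fourier_re f eta ^+ 2 + fourier_im f eta ^+ 2))%:E)%E.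

Definition sqnorm_half s j (psi : R -> R -> R) : \bar R :=
  (\sum_(m < j.+1)
     \int[lebesgue_measure]_eta
       (((1 + eta ^+ 2) ^+ (j - m))%:E *
        \int[lebesgue_measure]_(x2 in halfline s)
          (derive1n m (hat_re psi eta) x2 ^+ 2
           + derive1n m (hat_im psi eta) x2 ^+ 2)%:E))%E.

Definition sqnorm_Omega j (psi : side -> R -> R -> R) : \bar R :=
  (sqnorm_half Plus j (psi Plus) + sqnorm_half Minus j (psi Minus))%E.

(* The integrals and the iterated derive1n above are total operations: outside
   the following predicates the values of sqnorm_Gamma and sqnorm_half need not
   be meaningful. *)
Definition normable_Gamma (f : R -> R) : Prop :=
  lebesgue_measure.-integrable setT (EFin \o f).

Definition normable_half s j (psi : R -> R -> R) : Prop :=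
  (forall x2, halfline s x2 ->
     lebesgue_measure.-integrable setT (EFin \o (psi ^~ x2))) /\
  (forall eta x2 m, halfline s x2 -> (m < j)%N ->
     derivable (derive1n m (hat_re psi eta)) x2 1 /\
     derivable (derive1n m (hat_im psi eta)) x2 1).

(* Arguments: f t x1, and h s t x1 x2, v1 s t x1 x2, v2 s t x1 x2.  Only the
   values at t >= 0 and x2 in halfline_closed s are relevant; the values at
   x2 = 0 are the traces on Gamma (see [regular] below). *)
Record unknowns := Unknowns {
  uf : R -> R -> R;
  uh : side -> R -> R -> R -> R;
  uv1 : side -> R -> R -> R -> R;
  uv2 : side -> R -> R -> R -> R }.

Implicit Types U : unknowns.

Definition Hnorm j U t : \bar R :=
  (sqrte (sqnorm_Gamma j (uf U t))
   + sqrte (sqnorm_Omega j (fun s => uh U s t))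
   + sqrte (sqnorm_Omega j (fun s => uv1 U s t)
            + sqnorm_Omega j (fun s => uv2 U s t)))%E.

Definition in_H j U t : Prop :=
  [/\ normable_Gamma (uf U t),
      forall s, [/\ normable_half s j (uh U s t),
                    normable_half s j (uv1 U s t) &
                    normable_half s j (uv2 U s t)] &
      (Hnorm j U t < +oo)%E].

Definition dt (u : R -> R -> R -> R) (t x1 x2 : R) : R :=
  derive1 (fun r => u r x1 x2) t.
Definition d1 (u : R -> R -> R -> R) (t x1 x2 : R) : R :=
  derive1 (fun y => u t y x2) x1.
Definition d2 (u : R -> R -> R -> R) (t x1 x2 : R) : R :=
  derive1 (fun y => u t x1 y) x2.

Definition dtf (f : R -> R -> R) (t x1 : R) : R := derive1 (fun r => f r x1) t.
Definition d1f (f : R -> R -> R) (t x1 : R) : R := derive1 (fun y => f t y) x1.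

(* C^1 in the interior, continuous up to x2 = 0 and up to t = 0. *)
Definition regular_bulk s (u : R -> R -> R -> R) : Prop :=
  let D := [set p : R * R * R | 0 < p.1.1 /\ halfline s p.2] in
  let D' := [set p : R * R * R | 0 <= p.1.1 /\ halfline_closed s p.2] in
  [/\ {within D', continuous (fun p : R * R * R => u p.1.1 p.1.2 p.2)},
      forall t x1 x2, 0 < t -> halfline s x2 ->
        [/\ derivable (fun r => u r x1 x2) t 1,
            derivable (fun y => u t y x2) x1 1 &
            derivable (fun y => u t x1 y) x2 1],
      {within D, continuous (fun p : R * R * R => dt u p.1.1 p.1.2 p.2)},
      {within D, continuous (fun p : R * R * R => d1 u p.1.1 p.1.2 p.2)} &
      {within D, continuous (fun p : R * R * R => d2 u p.1.1 p.1.2 p.2)}].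

(* The x1-derivative is also required up to t = 0, where it enters the jump
   condition. *)
Definition regular_front (f : R -> R -> R) : Prop :=
  let D := [set p : R * R | 0 < p.1] in
  let D' := [set p : R * R | 0 <= p.1] in
  [/\ {within D', continuous (fun p : R * R => f p.1 p.2)},
      forall t x1, 0 < t -> derivable (fun r => f r x1) t 1,
      forall t x1, 0 <= t -> derivable (fun y => f t y) x1 1,
      {within D, continuous (fun p : R * R => dtf f p.1 p.2)} &
      {within D', continuous (fun p : R * R => d1f f p.1 p.2)}].

Definition regular U : Prop :=
  regular_front (uf U) /\
  forall s, [/\ regular_bulk s (uh U s), regular_bulk s (uv1 U s) &
                regular_bulk s (uv2 U s)].

(* The background velocity; vbar is its value in Omega^+. *)
Definition bg vbar s : R := match s with Plus => vbar | Minus => - vbar end.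

Definition bulk_equations c vbar U : Prop :=
  forall s t x1 x2, 0 < t -> halfline s x2 ->
  [/\ dt (uh U s) t x1 x2 + bg vbar s * d1 (uh U s) t x1 x2
        + (d1 (uv1 U s) t x1 x2 + d2 (uv2 U s) t x1 x2) = 0,
      dt (uv1 U s) t x1 x2 + bg vbar s * d1 (uv1 U s) t x1 x2
        + c ^+ 2 * d1 (uh U s) t x1 x2 = 0 &
      dt (uv2 U s) t x1 x2 + bg vbar s * d1 (uv2 U s) t x1 x2
        + c ^+ 2 * d2 (uh U s) t x1 x2 = 0].

Definition front_equation vbar U : Prop :=
  forall s t x1, 0 < t ->
    dtf (uf U) t x1 = uv2 U s t x1 0 - bg vbar s * d1f (uf U) t x1.

Definition jump (u : side -> R -> R -> R -> R) (t x1 : R) : R :=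
  u Plus t x1 0 - u Minus t x1 0.

Definition jump_conditions vbar U : Prop :=
  forall t x1, 0 <= t ->
    jump (uh U) t x1 = 0 /\ jump (uv2 U) t x1 = 2 * vbar * d1f (uf U) t x1.

Definition is_solution c vbar U : Prop :=
  [/\ regular U, bulk_equations c vbar U & front_equation vbar U].

End VortexSheet.

(* Main.v *)
Require Import Defs.
From mathcomp Require Import all_boot all_order all_algebra.
From mathcomp Require Import all_classical all_reals all_analysis.
From mathcomp Require Import measurable_realfun complex ring lra.

(** The problem has exact separated solutions whose growth rate is proportional
    to their frequency. For a frequency x > 0 take the front exp(x (lam t + i x1))
    and, on the two sides, unknowns proportional to x exp(x z) with
    z = lam t + i x1 -+ mu x2, where mu = p + i q above the front and its
    conjugate below it. Writing omega = lam + i V (V is the background velocity)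
    and K = |omega|^2, the wave equation for h asks mu^2 = 1 + omega^2 / c^2, and
    continuity of h across the front asks that omega^2 / mu be purely imaginary,
    say omega^2 = i kappa mu with kappa real. Eliminating mu, omega^2 and its
    conjugate are the roots of X^2 + (kappa^2 / c^2) X + kappa^2. Their product
    gives kappa = K, the sign being the one for which p > 0, and their sum gives
    K^2 = 2 c^2 (V^2 - lam^2), that is
    lam^2 = c sqrt(c^2 + 4 V^2) - V^2 - c^2, which is positive exactly when
    V < sqrt 2 * c ([dispersion_relation]). Then |mu| = 1, and the
    amplitudes of h, v1, v2 are 2 i q, conj(omega), omega above the front and
    2 i q, omega, conj(omega) below it, so that all the equations and jump
    conditions become polynomial identities ([bulk_sol], [front_sol],
    [jump_sol]).

    Plane waves are not in H^j, so they are superposed: the front is the real part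
    of the integral of w(x) exp(x (lam t + i x1)) for x in [l, l + 1], and likewise
    for the other unknowns. The weight w is a polynomial that vanishes to second
    order at both ends, so that the packets decay like 1 / x1^2. Since the
    frequencies stay in a bounded interval, the packets are defined for all times.

    The norms of the problem are expressed through Fourier transforms in x1, which
    must be computed: at eta > 0 the transform of a packet is pi times the weight at
    eta times an exponential, and at - eta it is the conjugate
    ([fourier_re_packet], [fourier_im_packet]). This is Fourier inversion, proved
    here by Abel summation ([int_osc_half_line]): with the convergence factor exp(- e y) the inner integral
    becomes the Poisson kernel e / (e^2 + x^2), whose mass concentrates at the
    origin as e tends to 0.

    With the transform concentrated on l <= |eta| <= l + 1, the H^j norm at time 0
    is at most d (1 + (l + 1)^2)^(j + 2) up to a constant, d being the size of the
    weight ([Hnorm_sol_le]), whereas every H^k norm at time t is at least d exp(l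
    lam t) up to a constant ([Hnorm_sol_ge]). For given n the size d is chosen so
    that the first quantity is of order 1 / n; as the exponential beats the
    polynomial ([expR_dominates]), a large l makes the second one exceed alpha for
    all t >= T0. *)

Set Implicit Arguments.
Unset Strict Implicit.
Unset Printing Implicit Defensive.

Import Order.TTheory GRing.Theory Num.Theory.
Import numFieldNormedType.Exports.

Local Open Scope classical_set_scope.
Local Open Scope ring_scope.

(** * Continuity of explicit expressions *)

Section Continuity.
Variables (R : realType) (T : topologicalType).
Implicit Types f g : T -> R.

Lemma cont_cst (c : R) : continuous (fun _ : T => c).
Proof. exact: cst_continuous. Qed.

Lemma cont_add f g : continuous f -> continuous g -> continuous (fun x => f x + g x).
Proof. by move=> cf cg x; apply: cvgD; [exact: cf|exact: cg]. Qed.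

Lemma cont_opp f : continuous f -> continuous (fun x => - f x).
Proof. by move=> cf x; apply: cvgN; exact: cf. Qed.

Lemma cont_mul f g : continuous f -> continuous g -> continuous (fun x => f x * g x).
Proof. by move=> cf cg x; apply: cvgM; [exact: cf|exact: cg]. Qed.

Lemma cont_pow f n : continuous f -> continuous (fun x => f x ^+ n).
Proof.
by move=> cf x; apply: (@continuous_comp _ _ _ f (fun y => y ^+ n));
  [exact: cf|exact: exprn_continuous].
Qed.

Lemma cont_norm f : continuous f -> continuous (fun x => `|f x|).
Proof.
by move=> cf x; apply: (@continuous_comp _ _ _ f (fun y => `|y|));
  [exact: cf|exact: norm_continuous].
Qed.

Lemma cont_comp (h : R -> R) f : continuous h -> continuous f ->
  continuous (fun x => h (f x)).
Proof. by move=> ch cf x; apply: (@continuous_comp _ _ _ f h); [exact: cf|exact: ch]. Qed.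

End Continuity.

Lemma cont_fst (T U V : topologicalType) (f : T -> U * V) :
  continuous f -> continuous (fun x => (f x).1).
Proof. by move=> cf x; apply: (@continuous_comp _ _ _ f fst); [exact: cf|exact: cvg_fst]. Qed.

Lemma cont_snd (T U V : topologicalType) (f : T -> U * V) :
  continuous f -> continuous (fun x => (f x).2).
Proof. by move=> cf x; apply: (@continuous_comp _ _ _ f snd); [exact: cf|exact: cvg_snd]. Qed.

Lemma cont_id (T : topologicalType) : continuous (fun x : T => x).
Proof. by move=> x; exact: cvg_id. Qed.

(** Proves continuity by recursion on the head symbol of the function. The
    syntactic match avoids the costly unification attempts of applying the
    closure lemmas one after the other. *)
Ltac cont := repeat first [assumption |
  lazymatch goal with |- continuous ?f =>
  lazymatch f with
  | (fun _ => ?c) => exact: cont_cst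
  | (fun x => x) => exact: cont_id
  | (fun x => @GRing.add _ (@?f x) (@?g x)) => apply: (@cont_add _ _ f g)
  | (fun x => @GRing.mul _ (@?f x) (@?g x)) => apply: (@cont_mul _ _ f g)
  | (fun x => @GRing.opp _ (@?f x)) => apply: (@cont_opp _ _ f)
  | (fun x => @GRing.exp _ (@?f x) ?n) => apply: (@cont_pow _ _ f n)
  | (fun x => expR (@?f x)) => apply: (@cont_comp _ _ expR f (@continuous_expR _))
  | (fun x => cos (@?f x)) => apply: (@cont_comp _ _ cos f (@continuous_cos _))
  | (fun x => sin (@?f x)) => apply: (@cont_comp _ _ sin f (@continuous_sin _))
  | (fun x => @Num.norm _ _ (@?f x)) => apply: (@cont_norm _ _ f)
  | (fun x => fst (@?f x)) => apply: (@cont_fst _ _ _ f)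
  | (fun x => snd (@?f x)) => apply: (@cont_snd _ _ _ f)
  | (fun x => ?h (@?f x)) => apply: (@cont_comp _ _ h f); [assumption|]
  end end].

(** * Complex exponentials in real form *)

Section Wave.
Variable R : realType.
Implicit Types (k z : R[i]) (a b s x : R).

(** The real part of k exp(a + i b). *)
Definition wave k a b : R := expR a * (complex.Re k * cos b - complex.Im k * sin b).

(** Along a line of direction zeta = a1 + i b1, differentiating k exp(z)
    multiplies the amplitude k by zeta. Every partial derivative below is an
    instance of this rule. *)
Lemma is_derive_wave k a0 a1 b0 b1 s :
  is_derive s 1 (fun s => wave k (a0 + s * a1) (b0 + s * b1))
    (wave (k * (a1 +i* b1)%C) (a0 + s * a1) (b0 + s * b1)).
Proof.
rewrite /wave; apply: is_derive_eq.
case: k => kr ki /=; rewrite /GRing.scale/=; ring.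
Qed.

Lemma waveD k1 k2 a b : wave (k1 + k2) a b = wave k1 a b + wave k2 a b.
Proof. case: k1 k2 => [? ?] [? ?]; rewrite /wave/=; ring. Qed.

Lemma normr_wave k a b : `|wave k a b| <= expR a * (`|complex.Re k| + `|complex.Im k|).
Proof.
rewrite /wave normrM (gtr0_norm (expR_gt0 _)) ler_pM2l ?expR_gt0//.
rewrite (le_trans (ler_normB _ _))// !normrM lerD//.
- by rewrite ler_piMr// ler_norml cos_geN1 cos_le1.
- by rewrite ler_piMr// ler_norml sin_geN1 sin_le1.
Qed.

(** The imaginary part of a complex number is the real part of its product by
    - i, so this is |k exp(a + i b)|^2. *)
Lemma wave_sqr k a b :
  wave k a b ^+ 2 + wave (- 'i%C * k) a b ^+ 2
  = expR (2 * a) * (complex.Re k ^+ 2 + complex.Im k ^+ 2).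
Proof.
rewrite /wave expRM_natl.
have -> : complex.Re k ^+ 2 + complex.Im k ^+ 2 =
    (complex.Re k ^+ 2 + complex.Im k ^+ 2) * (cos b ^+ 2 + sin b ^+ 2).
  by rewrite cos2Dsin2 mulr1.
by case: k => kr ki /=; ring.
Qed.

End Wave.

(** * Integrals of continuous functions on a segment *)

Section Segment.
Variable R : realType.
Implicit Types (f F : R -> R) (a b : R).
Notation mu := (@lebesgue_measure R).

Lemma derive_continuous f F : (forall x : R, is_derive x 1 F (f x)) -> continuous F.
Proof. by move=> dF x; apply/differentiable_continuous/derivable1_diffP. Qed.

Lemma integrable_segment a b f : continuous f ->
  mu.-integrable `[a, b] (EFin \o f).
Proof.
move=> cf; apply: continuous_compact_integrable; first exact: segment_compact.
exact: continuous_subspaceT.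
Qed.

Lemma Rint_FTC2 a b f F : a <= b -> continuous f ->
  (forall x : R, is_derive x 1 F (f x)) ->
  \int[mu]_(x in `[a, b]) f x = F b - F a.
Proof.
move=> ab cf dF; have cF := derive_continuous dF.
move: ab; rewrite le_eqVlt => /predU1P[<-|ab].
  by rewrite set_itv1 Rintegral_set1 subrr.
rewrite /Rintegral (@continuous_FTC2 _ f F)//.
- exact: continuous_subspaceT.
- split; first by move=> x _; have [] := dF x.
    by apply: cvg_at_right_filter; exact: cF.
  by apply: cvg_at_left_filter; exact: cF.
- by move=> x _; rewrite derive1E; have [_ ->] := dF x.
Qed.

Lemma le_norm_Rint a b f M : a <= b -> continuous f ->
  (forall x, a <= x <= b -> `|f x| <= M) ->
  `|\int[mu]_(x in `[a, b]) f x| <= M * (b - a).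
Proof.
move=> ab cf fM.
apply: (le_trans (le_normr_Rintegral _ _)) => //; first exact: integrable_segment.
have -> : M * (b - a) = \int[mu]_(x in `[a, b]) M.
  rewrite Rintegral_cst//= lebesgue_measure_itv/= lte_fin.
  by move: ab; rewrite le_eqVlt => /predU1P[->|->]//; rewrite ltxx subrr.
apply: le_Rintegral => //.
- by apply/integrable_norm/integrable_segment.
- by apply: integrable_segment; exact: cst_continuous.
Qed.

Lemma bounded_rectangle (h : R * R -> R) a b c d : continuous h ->
  exists M, forall x y, a <= x <= b -> c <= y <= d -> `|h (x, y)| <= M.
Proof.
move=> ch.
have : compact (h @` (`[a, b] `*` `[c, d])).
  apply: continuous_compact; first exact: continuous_subspaceT.
  by apply: compact_setX; exact: segment_compact.
move=> /compact_bounded[M [_ /(_ (M + 1))]].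
rewrite ltrDl ltr01 => /(_ isT) hM.
exists (M + 1) => x y xab ycd; apply: hM => /=.
by exists (x, y) => //; split; rewrite /= in_itv.
Qed.

(** Joint continuity of the derivative makes it bounded on the compact rectangle
    [s0 - 1, s0 + 1] x [a, b], which provides the dominating constant. *)
Lemma is_derive_Rint a b (g dg : R -> R -> R) (s0 : R) :
  (forall s x : R, is_derive s 1 (g ^~ x) (dg s x)) ->
  (forall s, continuous (g s)) ->
  continuous (fun p : R * R => dg p.1 p.2) ->
  is_derive s0 1 (fun s => \int[mu]_(x in `[a, b]) g s x)
    (\int[mu]_(x in `[a, b]) dg s0 x).
Proof.
move=> dgE cg cdg.
have [M hM] := bounded_rectangle (s0 - 1) (s0 + 1) a b cdg.
have I0 : `]s0 - 1, s0 + 1[%classic s0.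
  by rewrite /= in_itv/= ltrBlDr ltrDl ltr01.
have Ig x : `]s0 - 1, s0 + 1[%classic x -> mu.-integrable `[a, b] (EFin \o g x).
  by move=> _; exact: integrable_segment.
have Dg x y : `]s0 - 1, s0 + 1[%classic x -> `[a, b]%classic y ->
  derivable (g ^~ y) x 1 by move=> _ _; have [] := dgE x y.
have pE x y : partial1of2 g x y = dg x y.
  by rewrite partial1of2E; have [_ ->] := dgE x y.
have IM : mu.-integrable `[a, b] (EFin \o cst `|M|).
  by apply: integrable_segment; exact: cst_continuous.
have bM x y : `]s0 - 1, s0 + 1[%classic x -> `[a, b]%classic y ->
    `|partial1of2 g x y| <= `|M|.
  rewrite /= !in_itv/= pE => /andP[x1 x2] yab.
  by rewrite (le_trans (hM _ _ _ yab)) ?ler_norm ?(ltW x1) ?(ltW x2).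
have mI : measurable (`[a, b] : set (measurableTypeR R)) by [].
apply: DeriveDef.
  exact: (derivable_under_integral mI I0 Ig Dg (fun=> normr_ge0 M) IM bM).
rewrite -derive1E.
rewrite (differentiation_under_integral mI I0 Ig Dg (fun=> normr_ge0 M) IM bM).
by apply: eq_Rintegral => x _; exact: pE.
Qed.

Lemma RintD a b f g : continuous f -> continuous g ->
  \int[mu]_(x in `[a, b]) (f x + g x)
  = \int[mu]_(x in `[a, b]) f x + \int[mu]_(x in `[a, b]) g x.
Proof. by move=> cf cg; apply: RintegralD => //; exact: integrable_segment. Qed.

Lemma RintB a b f g : continuous f -> continuous g ->
  \int[mu]_(x in `[a, b]) (f x - g x)
  = \int[mu]_(x in `[a, b]) f x - \int[mu]_(x in `[a, b]) g x.
Proof. by move=> cf cg; apply: RintegralB => //; exact: integrable_segment. Qed.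

Lemma RintZ a b f r : continuous f ->
  \int[mu]_(x in `[a, b]) (r * f x) = r * \int[mu]_(x in `[a, b]) f x.
Proof. by move=> cf; apply: RintegralZl => //; exact: integrable_segment. Qed.

End Segment.

(** * Superpositions of exponentials *)

Section Packet.
Variables (R : realType) (l : R).
Notation mu := (@lebesgue_measure R).
Implicit Types (w : R -> R) (k : R[i]) (a b s : R).

(** The real part of the integral of k w(x) exp(x (a + i b)). *)
Definition packet w k a b : R :=
  \int[mu]_(x in `[l, l + 1]) (w x * wave k (x * a) (x * b)).

Lemma continuous_packet_integrand w k a b : continuous w ->
  continuous (fun x => w x * wave k (x * a) (x * b)).
Proof. by move=> cw; rewrite /wave; cont. Qed.

Lemma is_derive_packet w k a0 a1 b0 b1 s : continuous w ->
  is_derive s 1 (fun s => packet w k (a0 + s * a1) (b0 + s * b1))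
   (packet (fun x => x * w x) (k * (a1 +i* b1)%C) (a0 + s * a1) (b0 + s * b1)).
Proof.
move=> cw; rewrite /packet.
apply: (@is_derive_Rint _ _ _ (fun s x => w x * wave k (x * (a0 + s * a1)) (x * (b0 + s * b1)))
  (fun s x => x * w x * wave (k * (a1 +i* b1)%C) (x * (a0 + s * a1)) (x * (b0 + s * b1)))).
- move=> {}s x.
  have -> : (fun s => w x * wave k (x * (a0 + s * a1)) (x * (b0 + s * b1))) =
     (fun s => w x * wave k (x * a0 + s * (x * a1)) (x * b0 + s * (x * b1))).
    by apply/funext => r; congr (_ * wave _ _ _); ring.
  have H := is_derive_wave k (x * a0) (x * a1) (x * b0) (x * b1) s.
  apply: is_derive_eq; rewrite /wave /GRing.scale /=.
  have -> : x * a0 + s * (x * a1) = x * (a0 + s * a1) by ring.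
  have -> : x * b0 + s * (x * b1) = x * (b0 + s * b1) by ring.
  case: k {H} => kr ki /=; ring.
- by move=> r; exact: continuous_packet_integrand.
- by rewrite /wave; cont.
Qed.

Lemma packetD w k1 k2 a b : continuous w ->
  packet w (k1 + k2) a b = packet w k1 a b + packet w k2 a b.
Proof.
move=> cw; rewrite /packet -RintD; try exact: continuous_packet_integrand.
by apply: eq_Rintegral => x _; rewrite waveD mulrDr.
Qed.

Lemma packet0 w a b : packet w 0 a b = 0.
Proof.
rewrite /packet; under eq_Rintegral do rewrite /wave/= !mul0r subrr !mulr0.
by rewrite Rintegral_cst// mul0r.
Qed.

Lemma packetZ w r k a b : continuous w ->
  packet w (r%:C%C * k) a b = r * packet w k a b.
Proof.
move=> cw; rewrite /packet -RintZ; last exact: continuous_packet_integrand.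
apply: eq_Rintegral => x _; rewrite /wave; case: k => kr ki/=; ring.
Qed.

End Packet.

(** * Integrals over the line *)

Section HalfLines.
Variable R : realType.
Notation mu := (@lebesgue_measure R).
Implicit Types (f g : R -> R).

Lemma measurable_continuous (D : set R) f : measurable D -> continuous f ->
  measurable_fun D (EFin \o f).
Proof.
by move=> mD cf; apply/measurable_EFinP/measurable_funTS; exact: continuous_measurable_fun.
Qed.

Lemma ge0_integral_fold g : continuous g -> (forall y, 0 <= g y) ->
  (\int[mu]_y (g y)%:E
   = \int[mu]_(y in `[0%R, +oo[) (g y)%:E + \int[mu]_(y in `[0%R, +oo[) (g (- y))%:E)%E.
Proof.
move=> cg g0.
have mg : measurable_fun [set: R] (EFin \o g) by exact: measurable_continuous.
have -> : [set: R] = `]-oo, 0[%classic `|` `[0, +oo[%classic.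
  apply/seteqP; split => // x _ /=; rewrite !in_itv/= andbT.
  by case: (ltP x 0); [left|right].
rewrite ge0_integral_setU//=; last 3 first.
- exact: measurable_funTS.
- by move=> x _; rewrite lee_fin.
- apply/disj_set2P; apply/seteqP; split => // x /=.
  by rewrite !in_itv/= andbT => -[x0]; rewrite leNgt x0.
rewrite addeC; congr (_ + _)%E.
rewrite integral_itv_bndo_bndc; last by apply: measurable_funTS.
have := @ge0_integration_by_substitutionNy R g 0.
rewrite oppr0; apply => //.
by apply: continuous_subspaceT.
Qed.

(** The change of variables y -> - y is applied to the positive and to the
    negative part of f separately, where it holds without integrability. *)
Lemma integral_fold f : continuous f -> mu.-integrable setT (EFin \o f) ->
  (\int[mu]_y (f y))%R = \int[mu]_(y in `[0, +oo[) (f y + f (- y)).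
Proof.
move=> cf intf.
have cN g : continuous g -> continuous (fun y => g (- y)).
  by move=> cg; cont.
pose p y := 2^-1 * (`|f y| + f y).
pose q y := 2^-1 * (`|f y| - f y).
have cp : continuous p by rewrite /p; cont.
have cq : continuous q by rewrite /q; cont.
have p0 y : 0 <= p y.
  by rewrite mulr_ge0 ?invr_ge0// -lerBlDr sub0r -normrN ler_norm.
have q0 y : 0 <= q y by rewrite mulr_ge0 ?invr_ge0// subr_ge0 ler_norm.
have inf : mu.-integrable setT (EFin \o (fun y => `|f y|)) by exact: integrable_norm.
have ip : mu.-integrable setT (EFin \o p).
  have := integrableD measurableT inf intf.
  by move=> /(integrableZl measurableT (2^-1)); apply: eq_integrable.
have iq : mu.-integrable setT (EFin \o q).
  have := integrableB measurableT inf intf.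
  by move=> /(integrableZl measurableT (2^-1)); apply: eq_integrable.
have fE : f = fun y => p y - q y by apply/funext => y; rewrite /p /q; lra.
have half g : continuous g -> (forall y, 0 <= g y) ->
    mu.-integrable setT (EFin \o g) ->
    [/\ mu.-integrable `[0, +oo[ (EFin \o g),
        mu.-integrable `[0, +oo[ (EFin \o (fun y => g (- y))) &
        (\int[mu]_y (g y))%R = \int[mu]_(y in `[0, +oo[) g y
           + \int[mu]_(y in `[0, +oo[) g (- y)].
  move=> cg g0 ig.
  have ig1 : mu.-integrable `[0, +oo[ (EFin \o g) by exact: integrableS ig.
  have gE := ge0_integral_fold cg g0.
  have ig2 : mu.-integrable `[0, +oo[ (EFin \o (fun y => g (- y))).
    apply/integrableP; split; first by apply: measurable_continuous => //; exact: cN.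
    under eq_integral do rewrite /= ger0_norm//.
    apply: (@le_lt_trans _ _ (\int[mu]_y (g y)%:E)%E).
      rewrite gE leeDr// integral_ge0// => y _; by rewrite lee_fin.
    have /integrableP[_] := ig.
    by under eq_integral do rewrite /= ger0_norm//.
  split=> //; rewrite /Rintegral gE fineD//; exact: integrable_fin_num.
have [ip1 ip2 pE] := half _ cp p0 ip.
have [iq1 iq2 qE] := half _ cq q0 iq.
rewrite {1}fE RintegralB// pE qE fE.
transitivity (\int[mu]_(y in `[0, +oo[) ((p y + p (- y)) - (q y + q (- y)))).
  rewrite RintegralB//.
  - rewrite !RintegralD//; ring.
  - exact: (integrableD _ ip1 ip2).
  - exact: (integrableD _ iq1 iq2).
by apply: eq_Rintegral => y _; ring.
Qed.

Lemma oneDsqr_pos (y : R) : 0 < 1 + y ^+ 2.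
Proof. by rewrite ltr_pwDl// sqr_ge0. Qed.

Lemma integrable_inv_oneDsqr : mu.-integrable setT (EFin \o (fun y : R => (1 + y ^+ 2)^-1)).
Proof.
have c1 : continuous (fun y : R => (1 + y ^+ 2)^-1).
  exact: continuous_oneDsqrV.
have i0 (y : R) : 0 <= (1 + y ^+ 2)^-1 by rewrite invr_ge0 ltW// oneDsqr_pos.
apply/integrableP; split; first exact: measurable_continuous.
under eq_integral do rewrite /= ger0_norm//.
rewrite ge0_integral_fold//.
under [X in (_ + X)%E]eq_integral do rewrite sqrrN.
have -> : (\int[mu]_(y in `[0%R, +oo[) ((1 + y ^+ 2)^-1)%:E = (pi / 2)%:E)%E.
  by rewrite -integral0y_oneDsqr.
by rewrite -EFinD ltry.
Qed.

Lemma integrable_decay f K : continuous f ->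
  (forall y, `|f y| * (1 + y ^+ 2) <= K) -> mu.-integrable setT (EFin \o f).
Proof.
move=> cf fK.
have := integrableZl measurableT K integrable_inv_oneDsqr.
apply: le_integrable => //; first exact: measurable_continuous.
move=> y _ /=; rewrite lee_fin (le_trans _ (ler_norm _))//.
by rewrite ler_pdivlMr ?oneDsqr_pos.
Qed.

End HalfLines.

Lemma Rdominated_cvg (R : realType) (D : set (measurableTypeR R))
    (f_ : nat -> R -> R) (f g : R -> R) :
  measurable D -> (forall n, measurable_fun D (f_ n)) ->
  (forall x, D x -> f_ n x @[n --> \oo] --> f x) ->
  (@lebesgue_measure R).-integrable D (EFin \o g) ->
  (forall n x, D x -> `|f_ n x| <= g x) ->
  (\int[@lebesgue_measure R]_(x in D) f_ n x) @[n --> \oo]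
    --> \int[@lebesgue_measure R]_(x in D) f x.
Proof.
move=> mD mf ff ig fg.
have mf' n : measurable_fun D (EFin \o f_ n) by exact/measurable_EFinP.
have ff' x : D x -> (EFin \o f_ n) x @[n --> \oo] --> (EFin \o f) x.
  by move=> Dx; apply: cvg_EFin; [exact: nearW|exact: ff].
have mF : measurable_fun D (EFin \o f) by exact: emeasurable_fun_cvg mf' ff'.
have [iF _ H] := @dominated_convergence _ _ _ (@lebesgue_measure R) _ mD
  (fun n => EFin \o f_ n) _ (EFin \o g) mf' mF (aeW _ ff') ig
  (aeW _ (fun x n Dx => fg n x Dx)).
apply: fine_cvg; rewrite fineK//; exact: integrable_fin_num.
Qed.

Lemma bounded_segment (R : realType) (h : R -> R) a b : continuous h ->
  exists2 M, 0 <= M & forall x, a <= x <= b -> `|h x| <= M.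
Proof.
move=> ch.
have [|M hM] := @bounded_rectangle R (fun p => h p.1) a b 0 0.
  by cont.
exists `|M| => // x xab; rewrite (le_trans _ (ler_norm _))//.
by apply: (hM x 0) => //; rewrite lexx.
Qed.

(** * Fourier inversion on a half-line *)

Section OscillatoryIntegral.
Variables (R : realType) (l : R).
Notation mu := (@lebesgue_measure R).
Implicit Types (W : R -> R) (c d : R).

Definition osc_integral W (y phi : R) : R :=
  \int[mu]_(x in `[l, l + 1]) (W x * cos (x * y + phi)).

Lemma continuous_osc W c d : continuous W ->
  continuous (fun y => osc_integral W y (c * y + d)).
Proof.
move=> cW; apply: (@derive_continuous _ (fun y => \int[mu]_(x in `[l, l + 1])
  (W x * (- (x + c) * sin (x * y + (c * y + d)))))) => y.
apply: (@is_derive_Rint _ _ _ (fun y x => W x * cos (x * y + (c * y + d)))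
  (fun y x => W x * (- (x + c) * sin (x * y + (c * y + d))))).
- by move=> s x; apply: is_derive_eq; rewrite /GRing.scale /=; ring.
- by move=> s; cont.
- by cont.
Qed.

Lemma continuous_osc_shift W z : continuous W ->
  continuous (fun y => osc_integral W y (- (z * y))).
Proof.
move=> cW; have := @continuous_osc W (- z) 0 cW.
by under [X in continuous X -> _]eq_fun do rewrite addr0 mulNr.
Qed.

End OscillatoryIntegral.

Section Oscillatory.
Variable R : realType.
Notation mu := (@lebesgue_measure R).
Variables (l : R) (W W1 W2 : R -> R).
Hypothesis dW : forall x : R, is_derive x 1 W (W1 x).
Hypothesis dW1 : forall x : R, is_derive x 1 W1 (W2 x).
Hypothesis cW2 : continuous W2.
Hypothesis Wl : W l = 0.
Hypothesis Wr : W (l + 1) = 0.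
Hypothesis W1l : W1 l = 0.
Hypothesis W1r : W1 (l + 1) = 0.

Let cW : continuous W := derive_continuous dW.
Let cW1 : continuous W1 := derive_continuous dW1.
Let ll1 : l <= l + 1. Proof. by rewrite lerDl. Qed.

Local Notation osc := (osc_integral l W).

Let cont_Mcos (f : R -> R) y phi : continuous f ->
  continuous (fun x : R => f x * cos (x * y + phi)).
Proof. by move=> cf; cont. Qed.

(** Two integrations by parts, without boundary terms because W and its
    derivative vanish at both ends. The phase phi may depend on y, which gives
    cosine, sine and modulated integrals at once. *)
Lemma osc_decay : exists K, forall y phi, `|osc y phi| * (1 + y ^+ 2) <= K.
Proof.
have cD : continuous (fun x => W x - W2 x) by cont.
have [M M0 hM] := bounded_segment l (l + 1) cD.
exists M => y phi.
(* Integrating F' = f over the segment is the double integration by parts. *)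
pose F x := W1 x * cos (x * y + phi) + y * W x * sin (x * y + phi).
pose f x := W2 x * cos (x * y + phi) + y ^+ 2 * (W x * cos (x * y + phi)).
have dF (x : R) : is_derive x 1 F (f x).
  by apply: is_derive_eq; rewrite /f /GRing.scale /=; ring.
have cWc := @cont_Mcos _ y phi cW; have cW2c := @cont_Mcos _ y phi cW2.
have cZ : continuous (fun x => y ^+ 2 * (W x * cos (x * y + phi))) by cont.
have cf : continuous f by rewrite /f; cont.
have := Rint_FTC2 ll1 cf dF; rewrite /F Wl Wr W1l W1r !mulr0 !mul0r subrr => H.
have {}H : \int[mu]_(x in `[l, l + 1]) (W2 x * cos (x * y + phi)) + y ^+ 2 * osc y phi = 0.
  by rewrite -H /f RintD ?RintZ.
rewrite -(ger0_norm (ltW (oneDsqr_pos y))) -normrM.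
have -> : osc y phi * (1 + y ^+ 2)
   = \int[mu]_(x in `[l, l + 1]) ((W x - W2 x) * cos (x * y + phi)).
  under eq_Rintegral do rewrite mulrBl.
  by rewrite RintB// /osc_integral; move: H; rewrite /osc_integral; lra.
rewrite [leRHS](_ : _ = M * (l + 1 - l)); last by ring.
apply: le_norm_Rint => //; first exact: cont_Mcos.
move=> x xl; rewrite normrM -[leRHS]mulr1 ler_pM ?hM//.
by rewrite ler_norml cos_geN1 cos_le1.
Qed.

Definition cutoff (x : R) : R := if l <= x <= l + 1 then W x else 0.

(** The point y is arbitrary: outside the segment the value 0 of the cutoff is the
    value of W at the nearest end. *)
Lemma cutoff_lipschitz : exists2 L, 0 <= L &
  forall x y, l <= x <= l + 1 -> `|W x - cutoff y| <= L * `|x - y|.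
Proof.
have [L L0 hL] := bounded_segment l (l + 1) cW1.
have lip x y : l <= x -> x <= y -> y <= l + 1 -> `|W y - W x| <= L * `|y - x|.
  move=> lx xy yl.
  have [|c] := @MVT_segment R W W1 x y xy (fun z _ => dW z).
    exact: continuous_subspaceT.
  rewrite in_itv/= => /andP[xc cy] ->; rewrite normrM ler_wpM2r//.
  by rewrite hL// (le_trans lx)// (le_trans cy).
exists L => // x y /andP[lx xl]; rewrite /cutoff.
have [ly|yl] /= := leP l y; last first.
  rewrite subr0 -[W x]subr0 -Wl (le_trans (lip _ _ _ lx xl))//.
  rewrite ler_wpM2l// ger0_norm ?subr_ge0// ger0_norm ?subr_ge0; lra.
have [yl|yl] := leP y (l + 1); last first.
  rewrite subr0 -[W x]subr0 -Wr distrC (le_trans (lip _ _ lx xl (lexx _)))//.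
  by rewrite ler_wpM2l// [leRHS]distrC ger0_norm ?subr_ge0// ger0_norm ?subr_ge0; lra.
have [xy|yx] := leP x y.
  by rewrite distrC [`|x - y|]distrC lip.
by rewrite lip// ltW.
Qed.

(** The Poisson kernel of the half-plane, without the factor 1 / pi. *)
Definition poisson (e x : R) : R := e / (e ^+ 2 + x ^+ 2).

Lemma poisson_den (e x : R) : 0 < e -> 0 < e ^+ 2 + x ^+ 2.
Proof. by move=> e0; rewrite ltr_pwDl ?sqr_ge0// exprn_gt0. Qed.

Lemma cont_inv_poisson_den (T : topologicalType) (e : R) (f : T -> R) : 0 < e ->
  continuous f -> continuous (fun x => (e ^+ 2 + f x ^+ 2)^-1).
Proof.
move=> e0 cf x; apply: cvgV; first by rewrite gt_eqF// poisson_den.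
have : continuous (fun x => e ^+ 2 + f x ^+ 2) by cont.
exact.
Qed.

Lemma continuous_poisson (e z : R) : 0 < e -> continuous (fun x => poisson e (x - z)).
Proof.
by move=> e0; rewrite /poisson; cont; apply: cont_inv_poisson_den => //; cont.
Qed.

Lemma poisson_ge0 e x : 0 < e -> 0 <= poisson e x.
Proof. by move=> e0; rewrite divr_ge0 ?ltW// poisson_den. Qed.

Lemma int_poisson (e a b z : R) : 0 < e -> a <= b ->
  \int[mu]_(x in `[a, b]) poisson e (x - z) = atan ((b - z) / e) - atan ((a - z) / e).
Proof.
move=> e0 ab; apply: (Rint_FTC2 (F := fun x => atan ((x - z) / e)) ab).
  exact: continuous_poisson.
move=> x; apply: is_derive_eq; rewrite /poisson /GRing.scale /=.
have e_neq0 : e != 0 by rewrite gt_eqF.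
have d_neq0 : e ^+ 2 + (x - z) ^+ 2 != 0 by rewrite gt_eqF// poisson_den.
have -> : 1 + ((x - z) / e) ^+ 2 = (e ^+ 2 + (x - z) ^+ 2) / e ^+ 2.
  by field.
by field; rewrite ?e_neq0 ?d_neq0.
Qed.

Definition eps (m : nat) : R := m.+1%:R^-1.

Lemma eps_gt0 m : 0 < eps m. Proof. by rewrite invr_gt0. Qed.

Lemma cvg_eps : eps m @[m --> \oo] --> 0.
Proof. exact: cvg_harmonic. Qed.

Lemma cvg_divr_eps (d : R) : 0 < d -> d / eps m @[m --> \oo] --> +oo.
Proof.
move=> d0; under eq_fun do rewrite /eps invrK.
apply/cvgryPge => A; near=> m; rewrite -ler_pdivrMl//.
rewrite (@le_trans _ _ m%:R)// ?ler_nat//; near: m.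
exact: nbhs_infty_ger.
Unshelve. all: by end_near. Qed.

(** Write W(x) = (W(x) - W(z)) + W(z). The Lipschitz bound makes the first part of
    the integrand bounded, uniformly in the kernel width, and it tends to 0
    pointwise. The integral of the kernel itself is a difference of arctangents,
    which tends to pi when z is inside the segment; when z is an end point or lies
    outside, the factor W(z) is replaced by 0. *)
Lemma poisson_limit z :
  (\int[mu]_(x in `[l, l + 1]) (W x * poisson (eps m) (x - z))) @[m --> \oo]
    --> pi * cutoff z.
Proof.
have [L L0 hL] := cutoff_lipschitz.
have cP m : continuous (fun x => poisson (eps m) (x - z)).
  exact/continuous_poisson/eps_gt0.
have cWz m : continuous (fun x => (W x - cutoff z) * poisson (eps m) (x - z)).
  by move: (cP m) => cPm; apply: cont_mul => //; cont.
have bnd m x : l <= x <= l + 1 ->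
    `|(W x - cutoff z) * poisson (eps m) (x - z)|
      <= L * (`|x - z| * poisson (eps m) (x - z)).
  move=> xl; rewrite normrM (ger0_norm (poisson_ge0 _ (eps_gt0 m))) [leRHS]mulrA.
  by rewrite ler_wpM2r ?hL// poisson_ge0// eps_gt0.
have lim1 : (\int[mu]_(x in `[l, l + 1])
    ((W x - cutoff z) * poisson (eps m) (x - z))) @[m --> \oo] --> (0 : R).
  have -> : (0 : R) = \int[mu]_(x in `[l, l + 1]) 0.
    by rewrite Rintegral_cst// mul0r.
  apply: (@Rdominated_cvg R _ _ _ (cst L)) => //.
  - move=> m; apply: measurable_funTS; exact: continuous_measurable_fun.
  - move=> x /=; rewrite in_itv/= => xl; apply: norm_cvg0.
    apply: (@squeeze_cvgr _ _ _ _ (cst 0) (fun m => L / `|x - z| * eps m)).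
    + apply: nearW => m; rewrite normr_ge0/= (le_trans (bnd _ _ xl))// -mulrA ler_wpM2l//.
      have [->|xz] := eqVneq (x - z) 0; first by rewrite normr0 invr0 !mul0r.
      rewrite ler_pdivlMl ?normr_gt0// [leLHS]mulrA -expr2.
      rewrite real_normK ?num_real// /poisson mulrCA ler_piMr ?(ltW (eps_gt0 m))//.
      rewrite ler_pdivrMr ?poisson_den ?eps_gt0// mul1r lerDr sqr_ge0//.
    + exact: cvg_cst.
    + rewrite -(mulr0 (L / `|x - z|)); apply: cvgM; [exact: cvg_cst|exact: cvg_eps].
  - by apply: integrable_segment; exact: cst_continuous.
  - move=> m x /=; rewrite in_itv/= => xl.
    rewrite (le_trans (bnd _ _ xl))// ler_piMr// /poisson mulrA.
    rewrite ler_pdivrMr ?poisson_den ?eps_gt0// mul1r.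
    have := eps_gt0 m; rewrite -(@real_normK _ (x - z)) ?num_real//.
    by have := normr_ge0 (x - z); move: `|x - z| (eps m) => u e u0 e0; nra.
have -> : (fun m => \int[mu]_(x in `[l, l + 1]) (W x * poisson (eps m) (x - z))) =
   (fun m => \int[mu]_(x in `[l, l + 1]) ((W x - cutoff z) * poisson (eps m) (x - z))
     + cutoff z * (atan ((l + 1 - z) / eps m) - atan ((l - z) / eps m))).
  apply/funext => m; rewrite -int_poisson ?eps_gt0// -RintZ// -RintD//.
    by apply: eq_Rintegral => x _; ring.
  by move: (cP m) => cPm; apply: cont_mul => //; cont.
rewrite -[X in _ --> X]add0r; apply: cvgD => //.
have [/andP[lz zl]|nz] := boolP (l < z < l + 1); last first.
  have -> : cutoff z = 0.
    rewrite /cutoff; case: ifPn => // /andP[].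
    rewrite le_eqVlt => /predU1P[<- _|lz]; first exact: Wl.
    rewrite le_eqVlt => /predU1P[->|zl]; first exact: Wr.
    by rewrite lz zl in nz.
  by rewrite mulr0; under eq_fun do rewrite mul0r; exact: cvg_cst.
rewrite mulrC; apply: cvgM; first exact: cvg_cst.
rewrite [X in _ --> X](_ : _ = pi / 2 - - (pi / 2)); last by field.
apply: cvgB.
  by apply: (cvg_comp _ atan _ (@cvgy_atan R)); apply: cvg_divr_eps; rewrite subr_gt0.
under eq_fun do rewrite -opprB mulNr atanN.
apply: cvgN.
by apply: (cvg_comp _ atan _ (@cvgy_atan R)); apply: cvg_divr_eps; rewrite subr_gt0.
Qed.


(** A primitive in y of exp(- e y) cos(th y). *)
Definition damped (e th y : R) : R :=
  expR (- (e * y)) * (th * sin (th * y) - e * cos (th * y)) / (e ^+ 2 + th ^+ 2).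

Lemma is_derive_damped (e th y : R) : 0 < e ->
  is_derive y 1 (damped e th) (expR (- (e * y)) * cos (th * y)).
Proof.
move=> e0; have d0 : e ^+ 2 + th ^+ 2 != 0 by rewrite gt_eqF// poisson_den.
rewrite /damped; apply: is_derive_eq; rewrite /GRing.scale /=.
by field.
Qed.

Lemma norm_damped_le (e th y : R) : 0 < e ->
  `|damped e th y| <= expR (- (e * y)) * (2 / e).
Proof.
move=> e0; have d0 := poisson_den th e0.
rewrite /damped -mulrA normrM (gtr0_norm (expR_gt0 _)) ler_wpM2l ?expR_ge0//.
rewrite normrM (gtr0_norm (x := _^-1)) ?invr_gt0// ler_pdivrMr//.
apply: (@le_trans _ _ (`|th| + e)).
  rewrite (le_trans (ler_normB _ _))// !normrM (gtr0_norm e0) lerD//.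
    by rewrite ler_piMr// ler_norml sin_geN1 sin_le1.
  by rewrite ler_piMr ?(ltW e0)// ler_norml cos_geN1 cos_le1.
rewrite mulrAC ler_pdivlMr// -(@real_normK _ th) ?num_real//.
by have := normr_ge0 th; move: `|th| => u u0; nra.
Qed.

Lemma cont_W_damped (z e y : R) : 0 < e ->
  continuous (fun x => W x * damped e (x - z) y).
Proof.
by move=> e0; rewrite /damped; cont; apply: cont_inv_poisson_den => //; cont.
Qed.

(** The two integrals, over y and over the frequency x, are exchanged without
    Fubini: the integral over x of the primitives in y is a primitive of the
    integrand, and its value at y = 0 is minus the Poisson integral. *)
Lemma int_damped_osc z (e Y : R) : 0 < e -> 0 <= Y ->
  \int[mu]_(y in `[0, Y]) (osc y (- (z * y)) * expR (- (e * y)))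
  = \int[mu]_(x in `[l, l + 1]) (W x * damped e (x - z) Y)
    + \int[mu]_(x in `[l, l + 1]) (W x * poisson e (x - z)).
Proof.
move=> e0 Y0.
have cdamp y : continuous (fun x => W x * damped e (x - z) y).
  exact: cont_W_damped.
pose G y := \int[mu]_(x in `[l, l + 1]) (W x * damped e (x - z) y).
have dG (y : R) : is_derive y 1 G (osc y (- (z * y)) * expR (- (e * y))).
  have -> : osc y (- (z * y)) * expR (- (e * y)) =
      \int[mu]_(x in `[l, l + 1]) (W x * (expR (- (e * y)) * cos ((x - z) * y))).
    rewrite mulrC -RintZ; last exact: cont_Mcos.
    by apply: eq_Rintegral => x _; rewrite mulrCA mulrBl.
  apply: (@is_derive_Rint _ _ _ (fun y x => W x * damped e (x - z) y)
    (fun y x => W x * (expR (- (e * y)) * cos ((x - z) * y)))).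
  - move=> s x; have H := is_derive_damped (x - z) s e0.
    by apply: is_derive_eq; rewrite /GRing.scale /=; ring.
  - by move=> s; exact: cdamp.
  - by cont.
rewrite (Rint_FTC2 Y0 _ dG); last first.
  by have cT := @continuous_osc_shift R l W z cW; cont.
congr (_ + _); rewrite /G -[RHS]opprK; congr (- _).
rewrite -[RHS]mulN1r -RintZ; last first.
  by apply: cont_mul => //; exact: continuous_poisson.
apply: eq_Rintegral => x _.
by rewrite /damped /poisson !mulr0 oppr0 expR0 sin0 cos0; ring.
Qed.

(** Abel summation. The damping exp(- e y) and the truncation at Y are removed in a
    single dominated limit, with e = 1 / (m + 1) and Y = (m + 1)^2: then e tends to
    0, so that the Poisson integral tends to pi W(z), while e Y tends to infinity,
    so that the boundary term at Y disappears. *)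
Lemma int_osc_half_line z :
  \int[mu]_(y in `[0, +oo[) osc y (- (z * y)) = pi * cutoff z.
Proof.
have [K hK] := osc_decay.
have [M M0 hM] := bounded_segment l (l + 1) cW.
pose Y (m : nat) : R := m.+1%:R ^+ 2.
pose T y := osc y (- (z * y)).
pose g m y : R := T y * expR (- (eps m * y)).
have cT : continuous T by exact: continuous_osc_shift.
have cg m : continuous (g m) by rewrite /g; cont.
have lim1 : (\int[mu]_(y in `[0, +oo[) ((g m) \_ `[0, Y m]) y) @[m --> \oo]
    --> \int[mu]_(y in `[0, +oo[) T y.
  apply: (@Rdominated_cvg R _ _ _ (fun y => K * (1 + y ^+ 2)^-1)) => //.
  - move=> m; apply: measurable_funTS.
    apply: (measurable_restrictT (g m) (measurable_itv `[0, Y m])).1.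
    by apply: measurable_funTS; apply: (continuous_measurable_fun (cg m)).
  - move=> y /=; rewrite in_itv/= andbT => y0.
    have : g m y @[m --> \oo] --> T y * expR (- (0 * y)).
      apply: cvgM; first exact: cvg_cst.
      apply: continuous_cvg; first exact: continuous_expR.
      by apply: cvgN; apply: cvgM; [exact: cvg_eps|exact: cvg_cst].
    rewrite mul0r oppr0 expR0 mulr1; apply: cvg_trans; apply: near_eq_cvg.
    near=> m; rewrite patchE mem_set//= in_itv/= y0/= /Y.
    have mY : (m.+1%:R : R) <= m.+1%:R ^+ 2 by rewrite ler_eXnr// ler1n.
    rewrite (le_trans _ mY)//.
    rewrite (@le_trans _ _ m%:R)// ?ler_nat//; near: m.
    exact: nbhs_infty_ger.
  - apply: (@integrableS _ _ _ _ setT) => //.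
    exact: (integrableZl measurableT K (@integrable_inv_oneDsqr R)).
  - move=> m y /=; rewrite in_itv/= andbT => y0.
    have Ky : `|T y| <= K * (1 + y ^+ 2)^-1.
      rewrite ler_pdivlMr ?oneDsqr_pos //; exact: hK.
    rewrite patchE; case: ifP => _; last by rewrite normr0 (le_trans _ Ky).
    rewrite (le_trans _ Ky)// /g normrM ler_piMr// (gtr0_norm (expR_gt0 _)).
    by rewrite -expR0 ler_expR oppr_le0 mulr_ge0// ltW// eps_gt0.
have lim2 : (\int[mu]_(y in `[0, +oo[) ((g m) \_ `[0, Y m]) y) @[m --> \oo]
    --> pi * cutoff z.
  have -> : (fun m => \int[mu]_(y in `[0, +oo[) ((g m) \_ `[0, Y m]) y) =
    (fun m => \int[mu]_(x in `[l, l + 1]) (W x * damped (eps m) (x - z) (Y m))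
       + \int[mu]_(x in `[l, l + 1]) (W x * poisson (eps m) (x - z))).
    apply/funext => m; rewrite -int_damped_osc ?eps_gt0 ?sqr_ge0//.
    rewrite -Rintegral_mkcondr; congr (Rintegral _ _ _).
    apply/seteqP; split => y /=; rewrite !in_itv/= andbT; first by move=> [].
    by move=> /[dup] yY /andP[].
  rewrite -[X in _ --> X]add0r; apply: cvgD; last exact: poisson_limit.
  apply: norm_cvg0.
  apply: (@squeeze_cvgr _ _ _ _ (cst 0) (fun m => M * 4 * eps m)).
  - apply: nearW => m; rewrite normr_ge0/=.
    rewrite [leRHS](_ : _ = M * 4 * eps m * (l + 1 - l)); last by ring.
    apply: le_norm_Rint => //.
      exact/cont_W_damped/eps_gt0.
    move=> x xl; rewrite normrM -mulrA ler_pM ?hM//.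
    rewrite (le_trans (norm_damped_le _ _ (eps_gt0 m)))//.
    rewrite /eps /Y invrK expr2 mulrA mulVf ?pnatr_eq0// mul1r expRN.
    set n : R := m.+1%:R.
    have n0 : 0 < n by rewrite ltr0n.
    rewrite ler_pdivrMl ?expR_gt0//.
    have := expR_ge1Dxn 1 (ltW n0); rewrite (_ : 2`!%:R = 2 :> R)// => h.
    have : 2 * n <= n^-1 * 4 * (n ^+ 2 / 2).
      by rewrite le_eqVlt; apply/orP; left; apply/eqP; field; rewrite gt_eqF.
    move=> /le_trans; apply; rewrite [leRHS]mulrC [4 / n]mulrC ler_wpM2l//.
      by rewrite mulr_ge0 ?invr_ge0 ?ltW.
    by rewrite (le_trans _ h)// lerDr.
  - exact: cvg_cst.
  - rewrite -(mulr0 (M * 4)); apply: cvgM; [exact: cvg_cst|exact: cvg_eps].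
exact: (cvg_unique _ lim1 lim2).
Unshelve. all: try by end_near. Qed.

End Oscillatory.

(** * Fourier transforms of packets *)

Section Hats.
Variables (R : realType) (l : R).
Notation mu := (@lebesgue_measure R).
Implicit Types (A B w g : R -> R).

(** The second-order vanishing at the ends is what gives integrable Fourier
    transforms. *)
Definition window w : Prop := exists w1 w2 : R -> R,
  [/\ forall x : R, is_derive x 1 w (w1 x), forall x : R, is_derive x 1 w1 (w2 x),
      continuous w2, w l = 0 /\ w (l + 1) = 0 & w1 l = 0 /\ w1 (l + 1) = 0].

Lemma window_continuous w : window w -> continuous w.
Proof. by move=> [w1 [w2 [dw _ _ _ _]]]; exact: derive_continuous dw. Qed.

Lemma windowM w g g1 g2 : window w -> (forall x : R, is_derive x 1 g (g1 x)) ->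
  (forall x : R, is_derive x 1 g1 (g2 x)) -> continuous g2 ->
  window (fun x => w x * g x).
Proof.
move=> [w1 [w2 [dw dw1 cw2 [wl wr] [w1l w1r]]]] dg dg1 cg2.
have cw := derive_continuous dw; have cw1 := derive_continuous dw1.
have cg := derive_continuous dg; have cg1 := derive_continuous dg1.
exists (fun x => w1 x * g x + w x * g1 x).
exists (fun x => w2 x * g x + 2 * (w1 x * g1 x) + w x * g2 x); split.
- by move=> x; apply: is_derive_eq; rewrite /GRing.scale /=; ring.
- by move=> x; apply: is_derive_eq; rewrite /GRing.scale /=; ring.
- by cont.
- by rewrite wl wr !mul0r.
- by rewrite wl wr w1l w1r !mul0r addr0.
Qed.

Lemma window_osc w : window w ->
  (exists K, forall y phi, `|osc_integral l w y phi| * (1 + y ^+ 2) <= K) /\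
  (forall z, \int[mu]_(y in `[0, +oo[) osc_integral l w y (- (z * y)) = pi * cutoff l w z).
Proof.
move=> [w1 [w2 [dw dw1 cw2 [wl wr] [w1l w1r]]]]; split.
  exact: (osc_decay dw dw1 cw2 wl wr w1l w1r).
by move=> z; apply: (int_osc_half_line dw dw1 cw2 wl wr w1l w1r).
Qed.

(** The real part of the integral of (A(x) + i B(x)) exp(i x y). *)
Definition synthesis A B y : R :=
  \int[mu]_(x in `[l, l + 1]) (A x * cos (x * y) - B x * sin (x * y)).

Section Synthesis.
Variables (A B : R -> R).
Hypotheses (wA : window A) (wB : window B).
Let cA : continuous A := window_continuous wA.
Let cB : continuous B := window_continuous wB.

Lemma synthesisE y : synthesis A B y = osc_integral l A y 0 + osc_integral l B y (pi / 2).
Proof.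
rewrite /osc_integral -RintD; try by cont.
by apply: eq_Rintegral => x _; rewrite cosDpihalf addr0 mulrN.
Qed.

Lemma continuous_synthesis : continuous (synthesis A B).
Proof.
have -> : synthesis A B =
    fun y => osc_integral l A y (0 * y + 0) + osc_integral l B y (0 * y + pi / 2).
  by apply/funext => y; rewrite synthesisE !mul0r !add0r.
by apply: cont_add; exact: continuous_osc.
Qed.

Lemma synthesis_decay : exists K, forall y, `|synthesis A B y| * (1 + y ^+ 2) <= K.
Proof.
have [[KA hA] _] := window_osc wA; have [[KB hB] _] := window_osc wB.
exists (KA + KB) => y; rewrite synthesisE.
rewrite (le_trans _ (lerD (hA y 0) (hB y (pi / 2))))// -mulrDl ler_wpM2r ?ler_normD//.
by rewrite ltW ?oneDsqr_pos.
Qed.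

Lemma integrable_synthesis : mu.-integrable setT (EFin \o synthesis A B).
Proof.
have [K hK] := synthesis_decay.
exact: integrable_decay continuous_synthesis hK.
Qed.

Let integrable_synthesisM (f : R -> R) : continuous f -> (forall y, `|f y| <= 1) ->
  mu.-integrable setT (EFin \o (fun y => synthesis A B y * f y)).
Proof.
move=> cf f1; have [K hK] := synthesis_decay; have cs := continuous_synthesis.
apply: (@integrable_decay _ _ K); first by cont.
move=> y; rewrite (le_trans _ (hK y))// normrM ler_wpM2r ?ler_piMr//.
by rewrite ltW ?oneDsqr_pos.
Qed.

Lemma integrable_osc_half w z : window w ->
  mu.-integrable `[0, +oo[ (EFin \o (fun y => osc_integral l w y (- (z * y)))).
Proof.
move=> ww; have [[K hK] _] := window_osc ww.
apply: (@integrableS _ _ _ _ setT) => //.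
apply: (@integrable_decay _ _ K) => //.
exact: continuous_osc_shift (window_continuous ww).
Qed.

(** Folding the line onto the half-line keeps only the even part of the integrand,
    2 cos(x y) cos(eta y) = cos((x - eta) y) + cos((x + eta) y), and each term is a
    half-line inversion, at eta and at - eta. *)
Lemma fourier_re_synthesis eta : fourier_re (synthesis A B) eta
  = pi * (cutoff l A eta + cutoff l A (- eta)).
Proof.
have [_ hA] := window_osc wA; rewrite mulrDr -!hA /fourier_re integral_fold.
- rewrite -RintegralD//; [|exact: integrable_osc_half..].
  apply: eq_Rintegral => y _; rewrite mulNr cosN -mulrDl /osc_integral /synthesis.
  rewrite -RintD; try by cont.
  rewrite mulrC -RintZ; last by cont.
  rewrite -RintD; try by cont.
  apply: eq_Rintegral => x _.
  rewrite mulrN cosN sinN mulNr opprK mulrC [eta * y]mulrC.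
  rewrite cosB cosD; ring.
- by have := continuous_synthesis; move=> ?; cont.
- apply: integrable_synthesisM; first by cont.
  by move=> y; rewrite ler_norml cos_geN1 cos_le1.
Qed.

Lemma fourier_im_synthesis eta : fourier_im (synthesis A B) eta
  = pi * (cutoff l B eta - cutoff l B (- eta)).
Proof.
have [_ hB] := window_osc wB; rewrite mulrBr -!hB /fourier_im integral_fold.
- rewrite -[RHS]opprB; congr (- _).
  rewrite -RintegralB//; [|exact: integrable_osc_half..].
  apply: eq_Rintegral => y _.
  have -> : sin (- y * eta) = - sin (y * eta) by rewrite mulNr sinN.
  rewrite mulrN -mulrBl /osc_integral /synthesis -RintB; try by cont.
  rewrite mulrC -RintZ; last by cont.
  rewrite -RintB; try by cont.
  apply: eq_Rintegral => x _.
  rewrite mulrN cosN sinN mulNr opprK [eta * y]mulrC.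
  rewrite cosB cosD; ring.
- by have := continuous_synthesis; move=> ?; cont.
- apply: integrable_synthesisM; first by cont.
  by move=> y; rewrite ler_norml sin_geN1 sin_le1.
Qed.

End Synthesis.

End Hats.

Section PacketHat.
Variables (R : realType) (l : R).
Hypothesis l0 : 0 < l.
Notation mu := (@lebesgue_measure R).
Variable w : R -> R.
Hypothesis ww : window l w.
Implicit Types (k : R[i]) (a b eta : R).

Lemma window_wave k a b : window l (fun x => w x * wave k (x * a) (x * b)).
Proof.
pose g k (x : R) := wave k (0 + x * a) (0 + x * b).
have -> : (fun x => w x * wave k (x * a) (x * b)) = fun x => w x * g k x.
  by apply/funext => x; rewrite /g !add0r.
apply: (@windowM R l w _ (g (k * (a +i* b)%C)) (g (k * (a +i* b)%C * (a +i* b)%C))) => //.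
- by move=> x; exact: is_derive_wave.
- by move=> x; exact: is_derive_wave.
- by rewrite /g /wave; cont.
Qed.

(** Expanding exp(i x (y - b)) moves the shift b into the amplitudes. *)
Lemma packet_synthesis k a b :
  (fun y => packet l w k a (y - b)) =
  synthesis l (fun x => w x * wave k (x * a) (x * - b))
              (fun x => w x * wave (- 'i%C * k) (x * a) (x * - b)).
Proof.
apply/funext => y; rewrite /packet /synthesis; apply: eq_Rintegral => x _.
rewrite /wave [x * (y - b)]mulrDr cosD sinD; case: k => kr ki /=; ring.
Qed.

Lemma cutoffM g x : cutoff l (fun x => w x * g x) x = cutoff l w x * g x.
Proof. by rewrite /cutoff; case: ifP; rewrite ?mul0r. Qed.

Lemma cutoff_neg (g : R -> R) x : x <= 0 -> cutoff l g x = 0.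
Proof. by move=> x0; rewrite /cutoff leNgt (le_lt_trans x0). Qed.

(** The frequencies of the packet are positive, so that only one of the two terms
    is nonzero. *)
Lemma cutoff_even (g : R -> R) eta : cutoff l g eta + cutoff l g (- eta) = cutoff l g `|eta|.
Proof.
have [e0|e0] := leP 0 eta.
  by rewrite (cutoff_neg _ (x := - eta)) ?oppr_le0// addr0 ger0_norm.
by rewrite (cutoff_neg _ (ltW e0)) add0r ltr0_norm.
Qed.

Lemma cutoff_odd (g : R -> R) eta :
  cutoff l g eta - cutoff l g (- eta) = Num.sg eta * cutoff l g `|eta|.
Proof.
have [e0|e0|<-] := ltgtP 0 eta; last first.
- by rewrite oppr0 normr0 subrr sgr0 mul0r.
- by rewrite (cutoff_neg _ (ltW e0)) sub0r ltr0_norm// ltr0_sg// mulN1r.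
- rewrite (cutoff_neg _ (x := - eta)) ?oppr_le0 ?(ltW e0)// subr0 gtr0_norm//.
  by rewrite gtr0_sg// mul1r.
Qed.

Lemma fourier_re_packet k a b eta : fourier_re (fun y => packet l w k a (y - b)) eta
  = pi * cutoff l w `|eta| * wave k (`|eta| * a) (`|eta| * - b).
Proof.
rewrite packet_synthesis fourier_re_synthesis; try exact: window_wave.
by rewrite cutoff_even cutoffM mulrA.
Qed.

Lemma fourier_im_packet k a b eta : fourier_im (fun y => packet l w k a (y - b)) eta
  = Num.sg eta * pi * cutoff l w `|eta| * wave (- 'i%C * k) (`|eta| * a) (`|eta| * - b).
Proof.
rewrite packet_synthesis fourier_im_synthesis; try exact: window_wave.
by rewrite cutoff_odd cutoffM; ring.
Qed.

Lemma integrable_packet k a b :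
  mu.-integrable setT (EFin \o (fun y => packet l w k a (y - b))).
Proof.
by rewrite packet_synthesis; apply: integrable_synthesis; exact: window_wave.
Qed.

End PacketHat.

Section Derive1nWave.
Variable R : realType.
Implicit Types (k z : R[i]) (C a b : R).

Lemma derive1n_wave m C k a0 a1 b0 b1 :
  derive1n m (fun s => C * wave k (a0 + s * a1) (b0 + s * b1))
  = fun s => C * wave (k * (a1 +i* b1)%C ^+ m) (a0 + s * a1) (b0 + s * b1).
Proof.
elim: m => [|m IH]; first by rewrite derive1n0 expr0 mulr1.
rewrite derive1nS IH; apply/funext => s; rewrite derive1E.
have H := is_derive_wave (k * (a1 +i* b1)%C ^+ m) a0 a1 b0 b1 s.
have K : is_derive s 1 (fun s => C * wave (k * (a1 +i* b1)%C ^+ m) (a0 + s * a1) (b0 + s * b1))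
    (C * wave (k * (a1 +i* b1)%C ^+ m.+1) (a0 + s * a1) (b0 + s * b1)).
  by apply: is_derive_eq; rewrite /GRing.scale /= exprSr mulrA; ring.
by have [_ ->] := K.
Qed.

Lemma derivable_derive1n_wave m C k a0 a1 b0 b1 (x : R) :
  derivable (derive1n m (fun s => C * wave k (a0 + s * a1) (b0 + s * b1))) x 1.
Proof.
rewrite derive1n_wave.
have := is_derive_wave (k * (a1 +i* b1)%C ^+ m) a0 a1 b0 b1 x.
by move=> [H _]; apply: derivableM; [exact: derivable_cst|exact: H].
Qed.

Definition sqmod z : R := complex.Re z ^+ 2 + complex.Im z ^+ 2.

Lemma sqmodM z1 z2 : sqmod (z1 * z2) = sqmod z1 * sqmod z2.
Proof. case: z1 z2 => [? ?] [? ?]; rewrite /sqmod /=; ring. Qed.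

Lemma sqmodX z m : sqmod (z ^+ m) = sqmod z ^+ m.
Proof.
elim: m => [|m IH]; first by rewrite !expr0 /sqmod/= expr0n/= addr0 expr1n.
by rewrite !exprS sqmodM IH.
Qed.

Lemma sqmod_ge0 z : 0 <= sqmod z.
Proof. by rewrite addr_ge0// sqr_ge0. Qed.

End Derive1nWave.

(** * Nonnegative integrals *)

Section Integrals.
Variable R : realType.
Notation mu := (@lebesgue_measure R).

(** The integral of a nonnegative function is the supremum of the integrals of the
    simple functions below it, and a smaller function has fewer of these. The
    integrands of the norms are integrals themselves, and this form of monotonicity
    bounds them without a study of their measurability. *)
Lemma le_nn_integral (f g : R -> \bar R) : (forall x, (0 <= f x)%E) ->
  (forall x, (f x <= g x)%E) -> (\int[mu]_x f x <= \int[mu]_x g x)%E.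
Proof.
move=> f0 fg; have g0 x : (0 <= g x)%E by exact: le_trans (fg x).
rewrite !ge0_integralTE//; apply: ereal_sup_le => _ [h hf <-].
by exists h => //= x; exact: le_trans (hf x) (fg x).
Qed.

Lemma integral_indic_segment (K a b : R) : 0 <= K -> a < b ->
  (\int[mu]_x (K * \1_(`[a, b]) x)%:E = (K * (b - a))%:E)%E.
Proof.
move=> K0 ab; under eq_integral do rewrite EFinM.
rewrite ge0_integralZl_EFin//.
- have -> := @integral_indic _ _ R mu setT measurableT `[a, b]%classic (measurable_itv _).
  by rewrite setIT; have := @lebesgue_measure_itv R `[a, b]; rewrite /= lte_fin ab => ->.
- by apply/measurable_EFinP; exact: measurable_indic.
Qed.

Lemma integral_expRN_cy (r : R) : 0 < r ->
  (\int[mu]_(x in `[0%R, +oo[) (expR (- (r * x)))%:E = (r^-1)%:E)%E.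
Proof.
move=> r0.
have dF (x : R) : is_derive x 1 (fun x => - r^-1 * expR (- (r * x))) (expR (- (r * x))).
  by apply: is_derive_eq; rewrite /GRing.scale/=; field; rewrite gt_eqF.
rewrite (@ge0_continuous_FTC2y _ _ (fun x => - r^-1 * expR (- (r * x))) 0 0)//.
- by rewrite mulr0 oppr0 expR0 mulr1 sub0e EFinN oppeK.
- by apply: continuous_subspaceT; cont.
- rewrite -(mulr0 (- r^-1)); apply: cvgM; first exact: cvg_cst.
  apply: (cvg_comp (fun x => r * x) (fun x => expR (- x)) _ (@cvgr_expR R)).
  by apply: gt0_cvgMry.
- by apply: cvg_at_right_filter; exact: (derive_continuous dF).
- by move=> x _; rewrite derive1E; have [_ ->] := dF x.
Qed.

Definition side_sign (s : side) : R := match s with Plus => 1 | Minus => -1 end.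

Lemma integral_expRN_halfline s (r : R) : 0 < r ->
  (\int[mu]_(x in @halfline R s) (expR (- (r * (side_sign s * x))))%:E = (r^-1)%:E)%E.
Proof.
move=> r0; case: s => /=.
  rewrite integral_itv_obnd_cbnd; last first.
    by apply: (@measurable_continuous _ _ (fun x => expR (- (r * (_ * x))))) => //; cont.
  by under eq_integral do rewrite mul1r; exact: integral_expRN_cy.
rewrite integral_itv_bndo_bndc; last first.
  by apply: (@measurable_continuous _ _ (fun x => expR (- (r * (_ * x))))) => //; cont.
have := @ge0_integration_by_substitutionNy R (fun x => expR (- (r * (-1 * x)))) 0.
rewrite oppr0 => ->.
- rewrite -(integral_expRN_cy r0); apply: eq_integral => x _ /=.
  by rewrite mulN1r opprK.
- by apply: continuous_subspaceT; cont.
- by move=> x _; exact: expR_ge0.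
Qed.

End Integrals.

Lemma measurable_halfline (R : realType) s :
  measurable (@halfline R s : set (measurableTypeR R)).
Proof. by case: s => /=; exact: measurable_itv. Qed.

Ltac nonneg := repeat first
  [ assumption | exact: sqr_ge0 | exact: expR_ge0 | exact: sqmod_ge0
  | exact: pi_ge0 | exact: normr_ge0 | exact: ler01 | exact: ler0n
  | apply: ltW; assumption
  | apply: exprn_ge0 | apply: mulr_ge0 | apply: addr_ge0 | rewrite invr_ge0 ].

(** * Sobolev norms of packets *)

Section Norms.
Variables (R : realType) (l p q : R).
Hypothesis l1 : 1 <= l.
Hypothesis p0 : 0 < p.
Hypothesis pq1 : p ^+ 2 + q ^+ 2 = 1.
Notation mu := (@lebesgue_measure R).
Variable v : R -> R.
Hypothesis wv : window l v.
Variable V0 : R.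
Hypothesis hV : forall x, l <= x <= l + 1 -> `|v x| <= V0.
Implicit Types (k : R[i]) (a b eta : R) (s : side).

Let l0 : 0 < l := lt_le_trans ltr01 l1.

(** The sign of the side makes the packet decay away from the front. *)
Definition mode k s a : R -> R -> R :=
  fun y x2 => packet l v k (a - side_sign R s * p * x2) (y - q * x2).

Lemma hat_re_mode k s a eta : hat_re (mode k s a) eta =
  fun x2 => (pi * cutoff l v `|eta|) *
    wave k (`|eta| * a + x2 * - (`|eta| * side_sign R s * p)) (0 + x2 * - (`|eta| * q)).
Proof.
apply/funext => x2; rewrite /hat_re /mode fourier_re_packet//.
by congr (_ * wave _ _ _); ring.
Qed.

Lemma hat_im_mode k s a eta : hat_im (mode k s a) eta =
  fun x2 => (Num.sg eta * pi * cutoff l v `|eta|) *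
    wave (- 'i%C * k) (`|eta| * a + x2 * - (`|eta| * side_sign R s * p)) (0 + x2 * - (`|eta| * q)).
Proof.
apply/funext => x2; rewrite /hat_im /mode fourier_im_packet//.
by congr (_ * wave _ _ _); ring.
Qed.

Lemma normable_mode k s a j : normable_half s j (mode k s a).
Proof.
split=> [x2 _|eta x2 m _ _]; first exact: integrable_packet.
by rewrite hat_re_mode hat_im_mode; split; exact: derivable_derive1n_wave.
Qed.

(** The sign only matters at eta = 0, where the cutoff vanishes. *)
Lemma cutoff_sg_sqr eta : (Num.sg eta * cutoff l v `|eta|) ^+ 2 = cutoff l v `|eta| ^+ 2.
Proof.
rewrite exprMn sqr_sg; have [->|] := eqVneq eta 0; last by rewrite mul1r.
by rewrite normr0 cutoff_neg// expr0n/= mulr0.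
Qed.

Lemma sqr_hat_pair eta (X Y : R) :
  (pi * cutoff l v `|eta| * X) ^+ 2 + (Num.sg eta * pi * cutoff l v `|eta| * Y) ^+ 2
  = pi ^+ 2 * cutoff l v `|eta| ^+ 2 * (X ^+ 2 + Y ^+ 2).
Proof.
have -> : (Num.sg eta * pi * cutoff l v `|eta| * Y) ^+ 2 =
  pi ^+ 2 * (Num.sg eta * cutoff l v `|eta|) ^+ 2 * Y ^+ 2 by ring.
by rewrite cutoff_sg_sqr; ring.
Qed.

Lemma cutoff_le eta : cutoff l v eta ^+ 2 <= V0 ^+ 2.
Proof.
rewrite -[leLHS]real_normK ?num_real// lerXn2r ?nnegrE//.
  by rewrite (le_trans _ (hV (x := l) _))// lexx lerDl ler01.
rewrite /cutoff; case: ifP => [/hV//|_].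
by rewrite normr0 (le_trans _ (hV (x := l) _))// lexx lerDl ler01.
Qed.

(** Each derivative in x2 multiplies the amplitude by a complex number of modulus
    |eta|, because p^2 + q^2 = 1. *)
Lemma sqr_hat_mode k s a eta m x2 :
  derive1n m (hat_re (mode k s a) eta) x2 ^+ 2 + derive1n m (hat_im (mode k s a) eta) x2 ^+ 2
  = pi ^+ 2 * cutoff l v `|eta| ^+ 2 * sqmod k * eta ^+ 2 ^+ m * expR (2 * (`|eta| * a))
    * expR (- (2 * `|eta| * p * (side_sign R s * x2))).
Proof.
rewrite hat_re_mode hat_im_mode !derive1n_wave -[- 'i%C * k * _]mulrA.
rewrite sqr_hat_pair wave_sqr -/(sqmod _) sqmodM sqmodX.
have -> : sqmod (- (`|eta| * side_sign R s * p) +i* - (`|eta| * q))%C = eta ^+ 2.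
  rewrite /sqmod/= -[RHS]mulr1 -pq1 -(@real_normK _ eta) ?num_real//.
  by case: s => /=; ring.
have -> : 2 * (`|eta| * a + x2 * - (`|eta| * side_sign R s * p)) =
  2 * (`|eta| * a) + - (2 * `|eta| * p * (side_sign R s * x2)) by ring.
by rewrite expRD; ring.
Qed.

Lemma int_hat_mode k s a eta m :
  (\int[mu]_(x2 in halfline s)
     (derive1n m (hat_re (mode k s a) eta) x2 ^+ 2
      + derive1n m (hat_im (mode k s a) eta) x2 ^+ 2)%:E
   = (pi ^+ 2 * cutoff l v `|eta| ^+ 2 * sqmod k * eta ^+ 2 ^+ m * expR (2 * (`|eta| * a))
      / (2 * `|eta| * p))%:E)%E.
Proof.
under eq_integral do rewrite sqr_hat_mode EFinM.
have [->|eta0] := eqVneq eta 0.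
  rewrite normr0 cutoff_neg// expr0n/= mulr0 !mul0r.
  by under eq_integral do rewrite mul0e; rewrite integral0.
have r0 : 0 < 2 * `|eta| * p by rewrite !mulr_gt0 ?normr_gt0.
rewrite ge0_integralZl_EFin.
- by rewrite integral_expRN_halfline.
- exact: measurable_halfline.
- by move=> x _; rewrite lee_fin expR_ge0.
- apply: (@measurable_continuous _ _ (fun x => expR (- (2 * `|eta| * p * (side_sign R s * x))))).
    exact: measurable_halfline.
  by cont.
- by nonneg.
Qed.

Definition half_bound k a j : R :=
  j.+1%:R * ((1 + (l + 1) ^+ 2) ^+ j *
    (pi ^+ 2 * V0 ^+ 2 * sqmod k * expR (2 * ((l + 1) * a)) / (2 * p)) * (2 * (l + 1))).

(** The transform lives on l <= |eta| <= l + 1, where the factor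
    (1 + eta^2)^(j - m) eta^(2 m) is at most (1 + (l + 1)^2)^j; the decay in x2
    contributes 1 / (2 |eta| p). *)
Lemma sqnorm_half_mode_le k s a j : 0 <= a ->
  (sqnorm_half s j (mode k s a) <= (half_bound k a j)%:E)%E.
Proof.
move=> a0; rewrite /sqnorm_half.
pose B := (1 + (l + 1) ^+ 2) ^+ j *
    (pi ^+ 2 * V0 ^+ 2 * sqmod k * expR (2 * ((l + 1) * a)) / (2 * p)).
have nn : 0 <= l + 1 by rewrite addr_ge0// ltW.
have B0 : 0 <= B.
  by rewrite /B; nonneg.
apply: (@le_trans _ _ (\sum_(m < j.+1) (B * (2 * (l + 1)))%:E)%E); last first.
  by rewrite sumEFin lee_fin sumr_const card_ord /half_bound -/B [leRHS]mulr_natl.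
apply: lee_sum => m _.
have -> : B * (2 * (l + 1)) = B * ((l + 1) - - (l + 1)) by ring.
have lp : 0 < l + 1 := addr_gt0 l0 ltr01.
have nl : - (l + 1) < l + 1 by rewrite (lt_trans _ lp)// oppr_lt0.
rewrite -integral_indic_segment//.
apply: le_nn_integral => eta; rewrite int_hat_mode -EFinM lee_fin.
  by nonneg.
have [lel|nel] := boolP (l <= `|eta| <= l + 1); last first.
  by rewrite /cutoff (negbTE nel) expr0n/= mulr0 !mul0r mulr0 mulr_ge0.
move: (lel) => /andP[le1 le2].
rewrite indicE mem_set/= ?mulr1; last by rewrite in_itv/= -ler_norml.
have e2 : eta ^+ 2 <= (l + 1) ^+ 2 by rewrite -(@real_normK _ eta) ?num_real// lerXn2r ?nnegrE.
set X := pi ^+ 2 * V0 ^+ 2 * sqmod k * expR (2 * ((l + 1) * a)) / (2 * p).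
rewrite [leLHS](_ : _ = ((1 + eta ^+ 2) ^+ (j - m) * eta ^+ 2 ^+ m) *
  (pi ^+ 2 * cutoff l v `|eta| ^+ 2 * sqmod k * expR (2 * (`|eta| * a))
    / (2 * `|eta| * p))); last by ring.
apply: ler_pM.
- by nonneg.
- by nonneg.
- rewrite (@le_trans _ _ ((1 + eta ^+ 2) ^+ (j - m) * (1 + eta ^+ 2) ^+ m))//.
    apply: ler_wpM2l; first by nonneg.
    by rewrite lerXn2r ?nnegrE ?addr_ge0 ?sqr_ge0// lerDr.
  rewrite -exprD subnK; last by rewrite -ltnS.
  by rewrite lerXn2r ?nnegrE ?addr_ge0 ?sqr_ge0// lerD2l.
- apply: ler_pM; [by nonneg|by nonneg|..].
    apply: ler_pM; [by nonneg|by nonneg|..].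
      by rewrite ler_wpM2r ?sqmod_ge0// ler_wpM2l ?sqr_ge0 ?cutoff_le.
    by rewrite ler_expR ler_pM2l// ler_wpM2r.
  rewrite lef_pV2 ?posrE ?mulr_gt0// ?(lt_le_trans l0)//.
  by rewrite ler_pM2r// ler_peMr// (le_trans l1).
Qed.

Lemma sqr_fourier_packet k a eta :
  fourier_re (packet l v k a) eta ^+ 2 + fourier_im (packet l v k a) eta ^+ 2
  = pi ^+ 2 * cutoff l v `|eta| ^+ 2 * sqmod k * expR (2 * (`|eta| * a)).
Proof.
have -> : packet l v k a = fun y => packet l v k a (y - 0).
  by apply/funext => y; rewrite subr0.
rewrite fourier_re_packet// fourier_im_packet//.
by rewrite sqr_hat_pair wave_sqr -/(sqmod _); ring.
Qed.

Lemma normable_packet k a : normable_Gamma (packet l v k a).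
Proof.
have -> : packet l v k a = fun y => packet l v k a (y - 0).
  by apply/funext => y; rewrite subr0.
exact: integrable_packet.
Qed.

Definition front_bound k a j : R := (1 + (l + 1) ^+ 2) ^+ j *
    (pi ^+ 2 * V0 ^+ 2 * sqmod k * expR (2 * ((l + 1) * a))) * (2 * (l + 1)).

Lemma sqnorm_Gamma_packet_le k a j : 0 <= a ->
  (sqnorm_Gamma j (packet l v k a) <= (front_bound k a j)%:E)%E.
Proof.
move=> a0; rewrite /sqnorm_Gamma /front_bound.
have nn : 0 <= l + 1 by rewrite addr_ge0// ltW.
have -> : 2 * (l + 1) = ((l + 1) - - (l + 1)) by ring.
have lp : 0 < l + 1 := addr_gt0 l0 ltr01.
have nl : - (l + 1) < l + 1 by rewrite (lt_trans _ lp)// oppr_lt0.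
rewrite -integral_indic_segment//; last by nonneg.
apply: le_nn_integral => eta; rewrite sqr_fourier_packet lee_fin.
  by nonneg.
have [lel|nel] := boolP (l <= `|eta| <= l + 1); last first.
  rewrite /cutoff (negbTE nel) expr0n/= mulr0 !mul0r mulr0.
  by apply: mulr_ge0; [nonneg|rewrite indicE ler0n].
move: (lel) => /andP[le1 le2].
rewrite indicE mem_set/= ?mulr1; last by rewrite in_itv/= -ler_norml.
have e2 : eta ^+ 2 <= (l + 1) ^+ 2 by rewrite -(@real_normK _ eta) ?num_real// lerXn2r ?nnegrE.
apply: ler_pM; [by nonneg|by nonneg|..].
  by rewrite lerXn2r ?nnegrE ?addr_ge0 ?sqr_ge0// lerD2l.
apply: ler_pM; [by nonneg|by nonneg|..].
  by rewrite ler_wpM2r ?sqmod_ge0// ler_wpM2l ?sqr_ge0 ?cutoff_le.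
by rewrite ler_expR ler_pM2l// ler_wpM2r.
Qed.

(** Only the frequencies between l + b and l + 2 b are kept. *)
Lemma sqnorm_Gamma_packet_ge k a j d b : 0 <= a -> 0 < b -> 0 <= d ->
  (forall x, l + b <= x <= l + 2 * b -> d <= `|v x|) -> 2 * b <= 1 ->
  ((pi ^+ 2 * d ^+ 2 * sqmod k * expR (2 * (l * a)) * b)%:E
    <= sqnorm_Gamma j (packet l v k a))%E.
Proof.
move=> a0 b0 d0 hd b1; rewrite /sqnorm_Gamma.
have -> : pi ^+ 2 * d ^+ 2 * sqmod k * expR (2 * (l * a)) * b =
  pi ^+ 2 * d ^+ 2 * sqmod k * expR (2 * (l * a)) * ((l + 2 * b) - (l + b)) by ring.
have X0 : 0 <= pi ^+ 2 * d ^+ 2 * sqmod k * expR (2 * (l * a)).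
  by nonneg.
have bl : l + b < l + 2 * b by lra.
rewrite -integral_indic_segment//.
apply: le_nn_integral => eta; rewrite ?sqr_fourier_packet lee_fin.
  by apply: mulr_ge0 => //; rewrite indicE ler0n.
rewrite indicE; have [|nel] := boolP (eta \in _); last first.
  by rewrite mulr0; nonneg.
rewrite inE/= in_itv/= mulr1 => eb; move: (eb) => /andP[be eb2].
have eta0 : 0 <= eta by rewrite (le_trans _ be)// addr_ge0// ltW.
rewrite ger0_norm// -[leLHS]mul1r ler_pM//.
  by rewrite exprn_ege1// lerDl sqr_ge0.
apply: ler_pM; [by nonneg|by nonneg|..].
  rewrite ler_wpM2r ?sqmod_ge0// ler_wpM2l ?sqr_ge0// -[leRHS]real_normK ?num_real//.
  rewrite lerXn2r ?nnegrE// /cutoff ifT ?hd//; apply/andP; split; lra.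
by rewrite ler_expR ler_pM2l// ler_wpM2r//; lra.
Qed.

End Norms.

(** * The growing solutions *)

(** Joint continuity follows from the mean value theorem along the segment joining
    the two points, since the derivative along it is a packet again and is bounded
    on a neighbourhood. *)
Lemma continuous_packet (R : realType) (l : R) (w : R -> R) (k : R[i]) : continuous w ->
  continuous (fun z : R * R => packet l w k z.1 z.2).
Proof.
move=> cw [a0 b0].
pose xw x := x * w x.
have cxw : continuous xw by rewrite /xw; cont.
have [M M0 hM] := bounded_segment l (l + 1) cxw.
pose E := expR ((`|l| + 1) * (`|a0| + 1)).
pose C := M * E * (`|complex.Re k| + `|complex.Im k|).
have C0 : 0 <= C by rewrite !mulr_ge0 ?expR_ge0 ?addr_ge0.
have lip a b : `|a - a0| <= 1 ->
    `|packet l w k a b - packet l w k a0 b0| <= C * (`|a - a0| + `|b - b0|).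
  move=> a1.
  pose z := ((a - a0) +i* (b - b0))%C.
  pose h s := packet l w k (a0 + s * (a - a0)) (b0 + s * (b - b0)).
  pose dh s := packet l xw (k * z) (a0 + s * (a - a0)) (b0 + s * (b - b0)).
  have dhE (s : R) : is_derive s 1 h (dh s) by exact: is_derive_packet.
  have ch : {within `[0, 1], continuous h}.
    by apply: continuous_subspaceT; exact: derive_continuous dhE.
  have [s] := @MVT_segment R h dh 0 1 ler01 (fun s _ => dhE s) ch.
  rewrite in_itv/= => /andP[s0 s1]; rewrite subr0 mulr1.
  have -> : h 1 = packet l w k a b by rewrite /h !mul1r !subrKC.
  have -> : h 0 = packet l w k a0 b0 by rewrite /h !mul0r !addr0.
  move=> ->; rewrite /dh /packet.
  rewrite [leRHS](_ : _ = C * (`|a - a0| + `|b - b0|) * (l + 1 - l)); last by ring.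
  apply: le_norm_Rint; [by rewrite lerDl|exact: continuous_packet_integrand|].
  move=> x /andP[lx xl].
  rewrite normrM /C -!mulrA ler_pM ?hM ?lx//.
  rewrite (le_trans (normr_wave _ _ _))// ler_pM ?expR_ge0 ?addr_ge0//.
    rewrite ler_expR (le_trans (ler_norm _))// normrM ler_pM//.
      rewrite ler_norml; apply/andP; split.
        by rewrite (le_trans _ lx)// lerNl (le_trans (ler_norm _))// normrN lerDl.
      by rewrite (le_trans xl)// lerD2r ler_norm.
    rewrite (le_trans (ler_normD _ _))// lerD2l normrM -[leRHS]mulr1 ler_pM//.
    by rewrite ger0_norm.
  case: (k) => kr ki /=.
  rewrite (le_trans (lerD (ler_normB _ _) (ler_normD _ _)))// !normrM.
  by rewrite le_eqVlt; apply/orP; left; apply/eqP; ring.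
apply/cvgrPdist_le => /= e e0.
have C1 : 0 < C + 1 by rewrite ltr_wpDl.
have r0 : 0 < Num.min 1 (e / (C + 1) / 2) by rewrite lt_min ltr01 !divr_gt0.
exists (ball a0 (Num.min 1 (e / (C + 1) / 2)), ball b0 (Num.min 1 (e / (C + 1) / 2))) => /=.
  by split; exact: nbhsx_ballx.
move=> [a b] [] /=; rewrite /ball/= !lt_min distrC [`|b0 - b|]distrC.
move=> /andP[a1 ae] /andP[_ be].
rewrite distrC (le_trans (lip _ _ (ltW a1)))//.
rewrite (@le_trans _ _ ((C + 1) * (e / (C + 1))))//.
  by apply: ler_pM; [exact: C0|nonneg|rewrite lerDl ler01|lra].
by rewrite mulrC divfK// gt_eqF.
Qed.

Lemma eq_packet (R : realType) (l : R) (w : R -> R) (k k' : R[i]) (a a' b b' : R) :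
  k = k' -> a = a' -> b = b' -> packet l w k a b = packet l w k' a' b'.
Proof. by move=> -> -> ->. Qed.

Section Solution.
Variables (R : realType) (l c V lam p q K : R).
Hypothesis K0 : K != 0.
Hypothesis HK : K = lam ^+ 2 + V ^+ 2.
Hypothesis Kp : K * p = 2 * lam * V.
Hypothesis Kq : K * q = V ^+ 2 - lam ^+ 2.
Hypothesis Kc : K = c ^+ 2 * (2 * q).
Variable w : R -> R.
Hypothesis cw : continuous w.
Implicit Types (k : R[i]) (s : side) (g : R -> R) (t : R).

Let v x := x * w x.
Let cv : continuous v. Proof. by rewrite /v; cont. Qed.
Let vv x := x * v x.
Let cvv : continuous vv. Proof. by rewrite /vv; cont. Qed.

Let fld (g : R -> R) k s : R -> R -> R -> R :=
  fun t x1 x2 => packet l g k (lam * t - side_sign R s * p * x2) (x1 - q * x2).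

Lemma continuous_fld g k s : continuous g ->
  continuous (fun P : R * R * R => fld g k s P.1.1 P.1.2 P.2).
Proof.
move=> cg; rewrite /fld => P.
pose z (P : R * R * R) : R * R := (lam * P.1.1 - side_sign R s * p * P.2, P.1.2 - q * P.2).
apply: (@continuous_comp _ _ _ z (fun z => packet l g k z.1 z.2)).
  have c1 : continuous (fun P : R * R * R => lam * P.1.1 - side_sign R s * p * P.2) by cont.
  have c2 : continuous (fun P : R * R * R => P.1.2 - q * P.2) by cont.
  exact: (cvg_pair (c1 P) (c2 P)).
exact: continuous_packet.
Qed.

Lemma is_derive_fld_t g k s t (x1 x2 : R) : continuous g ->
  is_derive t 1 (fun r => fld g k s r x1 x2) (fld (fun x => x * g x) (k * (lam +i* 0)%C) s t x1 x2).
Proof.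
move=> cg; have := is_derive_packet l k (- (side_sign R s * p * x2)) lam (x1 - q * x2) 0 t cg.
rewrite [X in is_derive _ _ X _](_ : _ = (fun r => fld g k s r x1 x2)); last first.
  by apply/funext => r; apply: eq_packet => //; ring.
by move=> /is_derive_eq; apply; apply: eq_packet => //; ring.
Qed.

Lemma is_derive_fld_1 g k s t (x1 x2 : R) : continuous g ->
  is_derive x1 1 (fun y => fld g k s t y x2) (fld (fun x => x * g x) (k * (0 +i* 1)%C) s t x1 x2).
Proof.
move=> cg; have := is_derive_packet l k (lam * t - side_sign R s * p * x2) 0 (- (q * x2)) 1 x1 cg.
rewrite [X in is_derive _ _ X _](_ : _ = (fun y => fld g k s t y x2)); last first.
  by apply/funext => r; apply: eq_packet => //; ring.
by move=> /is_derive_eq; apply; apply: eq_packet => //; ring.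
Qed.

Lemma is_derive_fld_2 g k s t (x1 x2 : R) : continuous g ->
  is_derive x2 1 (fun y => fld g k s t x1 y)
    (fld (fun x => x * g x) (k * (- (side_sign R s * p) +i* - q)%C) s t x1 x2).
Proof.
move=> cg; have := is_derive_packet l k (lam * t) (- (side_sign R s * p)) x1 (- q) x2 cg.
rewrite [X in is_derive _ _ X _](_ : _ = (fun y => fld g k s t x1 y)); last first.
  by apply/funext => r; apply: eq_packet => //; ring.
by move=> /is_derive_eq; apply; apply: eq_packet => //; ring.
Qed.

Lemma dt_fld g k s : continuous g -> dt (fld g k s) = fld (fun x => x * g x) (k * (lam +i* 0)%C) s.
Proof.
move=> cg; apply/funext => t; apply/funext => x1; apply/funext => x2.
by rewrite /dt derive1E; have [_ ->] := is_derive_fld_t k s t x1 x2 cg.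
Qed.

Lemma d1_fld g k s : continuous g -> d1 (fld g k s) = fld (fun x => x * g x) (k * (0 +i* 1)%C) s.
Proof.
move=> cg; apply/funext => t; apply/funext => x1; apply/funext => x2.
by rewrite /d1 derive1E; have [_ ->] := is_derive_fld_1 k s t x1 x2 cg.
Qed.

Lemma d2_fld g k s : continuous g ->
  d2 (fld g k s) = fld (fun x => x * g x) (k * (- (side_sign R s * p) +i* - q)%C) s.
Proof.
move=> cg; apply/funext => t; apply/funext => x1; apply/funext => x2.
by rewrite /d2 derive1E; have [_ ->] := is_derive_fld_2 k s t x1 x2 cg.
Qed.

Lemma regular_fld k s : regular_bulk s (fld v k s).
Proof.
split.
- by apply: continuous_subspaceT; exact: continuous_fld.
- move=> t x1 x2 _ _; split.
  + by have [] := is_derive_fld_t k s t x1 x2 cv.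
  + by have [] := is_derive_fld_1 k s t x1 x2 cv.
  + by have [] := is_derive_fld_2 k s t x1 x2 cv.
- by rewrite dt_fld//; apply: continuous_subspaceT; exact: continuous_fld.
- by rewrite d1_fld//; apply: continuous_subspaceT; exact: continuous_fld.
- by rewrite d2_fld//; apply: continuous_subspaceT; exact: continuous_fld.
Qed.

(** The amplitudes come from eliminating the unknowns one at a time: v2 from the
    equation of the front, h from the equation of v2, v1 from its own equation. The
    front carries the weight w and the other unknowns the weight x w(x), because
    they are one derivative rougher. *)
Definition solution : unknowns R := Unknowns
  (fun t => packet l w 1 (lam * t))
  (fun s t => mode l p q v (0 +i* (2 * q))%C s (lam * t))
  (fun s t => mode l p q v (lam +i* - (side_sign R s * V))%C s (lam * t))
  (fun s t => mode l p q v (lam +i* (side_sign R s * V))%C s (lam * t)).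

Let front_fld : uf solution = fun t x1 => fld w 1 Plus t x1 0.
Proof. by apply/funext => t; apply/funext => x1; rewrite /= /fld !mulr0 !subr0. Qed.

Lemma dtf_sol : dtf (uf solution) = fun t x1 => fld v (lam +i* 0)%C Plus t x1 0.
Proof.
rewrite front_fld; apply/funext => t; apply/funext => x1.
rewrite /dtf derive1E; have [_ ->] := is_derive_fld_t 1 Plus t x1 0 cw.
by rewrite mul1r.
Qed.

Lemma d1f_sol : d1f (uf solution) = fun t x1 => fld v (0 +i* 1)%C Plus t x1 0.
Proof.
rewrite front_fld; apply/funext => t; apply/funext => x1.
rewrite /d1f derive1E; have [_ ->] := is_derive_fld_1 1 Plus t x1 0 cw.
by rewrite mul1r.
Qed.

Lemma continuous_trace g k : continuous g ->
  continuous (fun P : R * R => fld g k Plus P.1 P.2 0).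
Proof.
move=> cg P; apply: (@continuous_comp _ _ _ (fun P : R * R => (P, 0 : R))
  (fun P : R * R * R => fld g k Plus P.1.1 P.1.2 P.2)).
  exact: (cvg_pair (@cvg_id _ (nbhs P)) (cvg_cst (0 : R))).
exact: continuous_fld.
Qed.

Lemma regular_sol : regular solution.
Proof.
split; last by move=> s; split; exact: regular_fld.
split.
- by rewrite front_fld; apply: continuous_subspaceT; exact: continuous_trace.
- by move=> t x1 _; rewrite front_fld; have [] := is_derive_fld_t 1 Plus t x1 0 cw.
- by move=> t x1 _; rewrite front_fld; have [] := is_derive_fld_1 1 Plus t x1 0 cw.
- by rewrite dtf_sol; apply: continuous_subspaceT; exact: continuous_trace.
- by rewrite d1f_sol; apply: continuous_subspaceT; exact: continuous_trace.
Qed.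

(* The divergence equation for the amplitudes, in real and imaginary parts. *)
Let dispersion_lam : p * lam = V * (1 - q).
Proof. by apply: (mulfI K0); rewrite mulrA Kp mulrCA mulrBr Kq HK; ring. Qed.

Let dispersion_V : p * V = lam * (1 + q).
Proof. by apply: (mulfI K0); rewrite mulrA Kp mulrCA mulrDr Kq HK; ring. Qed.

Let bgE s : bg V s = side_sign R s * V. Proof. by case: s => /=; ring. Qed.

Let sgn2 s : side_sign R s * side_sign R s = 1. Proof. by case: s => /=; ring. Qed.

Lemma fldD g k1 k2 s t x1 x2 : continuous g ->
  fld g k1 s t x1 x2 + fld g k2 s t x1 x2 = fld g (k1 + k2) s t x1 x2.
Proof. by move=> cg; rewrite /fld packetD. Qed.

Lemma fldZ g r k s t (x1 x2 : R) : continuous g ->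
  r * fld g k s t x1 x2 = fld g (r%:C%C * k) s t x1 x2.
Proof. by move=> cg; rewrite /fld packetZ. Qed.

Lemma fld0 g s t x1 x2 : fld g 0 s t x1 x2 = 0.
Proof. by rewrite /fld packet0. Qed.

(** Each equation says that a packet of known complex amplitude is zero, and the
    amplitude vanishes by the dispersion relation. *)
Lemma bulk_sol : bulk_equations c V solution.
Proof.
move=> s t x1 x2 _ _.
have -> : uh solution s = fld v (0 +i* (2 * q))%C s by [].
have -> : uv1 solution s = fld v (lam +i* - (side_sign R s * V))%C s by [].
have -> : uv2 solution s = fld v (lam +i* (side_sign R s * V))%C s by [].
rewrite !(dt_fld _ _ cv) !(d1_fld _ _ cv) !(d2_fld _ _ cv) !bgE.
rewrite !(fldZ _ _ _ _ _ _ cvv) !(fldD _ _ _ _ _ _ cvv).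
have := dispersion_lam; have := dispersion_V; have := sgn2 s; move: (side_sign R s) => sg sg2 e1 e2.
have C0 k : complex.Re k = 0 -> complex.Im k = 0 -> fld vv k s t x1 x2 = 0.
  by case: k => kr ki /= -> ->; exact: fld0.
split; apply: C0 => /=.
- have : sg * (p * lam) = sg * (V * (1 - q)) by rewrite e2.
  have : sg * sg * (V * q) = V * q by rewrite sg2 mul1r.
  by move=> h1 h2; lra.
- have : sg * sg * (p * V) = p * V by rewrite sg2 mul1r.
  by move=> h1; lra.
- have : sg * sg * (V * V) = V * V by rewrite sg2 mul1r.
  by move=> h1; move: HK Kc; rewrite !expr2; lra.
- lra.
- have h1 : sg * sg * (V * V) = V * V by rewrite sg2 mul1r.
  have h2 : c ^+ 2 * (2 * q) * q = V ^+ 2 - lam ^+ 2 by rewrite -Kc.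
  by move: h2; rewrite !expr2; lra.
- have h1 : c ^+ 2 * (2 * q) * p * sg = 2 * lam * V * sg by rewrite -Kc Kp.
  by move: h1; rewrite !expr2; lra.
Qed.

(** On the front the two sides differ only through their amplitudes. *)
Lemma fld_trace g k s t (x1 : R) : fld g k s t x1 0 = fld g k Plus t x1 0.
Proof. by rewrite /fld !mulr0. Qed.

Lemma front_sol : front_equation V solution.
Proof.
move=> s t x1 _; rewrite dtf_sol d1f_sol bgE -mulNr.
have -> : uv2 solution s t x1 0 = fld v (lam +i* (side_sign R s * V))%C s t x1 0 by [].
rewrite fld_trace (fldZ _ _ _ _ _ _ cv) (fldD _ _ _ _ _ _ cv); apply: eq_packet => //.
by apply/eqP; rewrite eq_complex /=; apply/andP; split; apply/eqP; ring.
Qed.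

Lemma jump_sol : jump_conditions V solution.
Proof.
move=> t x1 _; rewrite d1f_sol /jump; split.
  have E s : uh solution s t x1 0 = fld v (0 +i* (2 * q))%C s t x1 0 by [].
  by rewrite !E [X in _ - X]fld_trace subrr.
have E s : uv2 solution s t x1 0 = fld v (lam +i* (side_sign R s * V))%C s t x1 0 by [].
rewrite !E [X in _ - X]fld_trace -[X in _ - X]mul1r -mulNr.
rewrite !(fldZ _ _ _ _ _ _ cv) (fldD _ _ _ _ _ _ cv); apply: eq_packet => //.
by apply/eqP; rewrite eq_complex /=; apply/andP; split; apply/eqP; ring.
Qed.

End Solution.

(** With S = sqrt(c^2 + 4 V^2) one has lam^2 + V^2 = c (S - c), whose square is
    2 c^2 (V^2 - lam^2). *)
Lemma dispersion_relation (R : realType) (c V : R) : 0 < c -> 0 < V -> V / c < Num.sqrt 2 ->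
  exists lam K p q : R, [/\ 0 < lam, 0 < p /\ p ^+ 2 + q ^+ 2 = 1, K = lam ^+ 2 + V ^+ 2,
    [/\ K != 0, K * p = 2 * lam * V & K * q = V ^+ 2 - lam ^+ 2] & K = c ^+ 2 * (2 * q)].
Proof.
move=> c0 V0 M2.
have hV : V ^+ 2 < 2 * c ^+ 2.
  move: M2; rewrite ltr_pdivrMr// => h.
  have -> : 2 * c ^+ 2 = (Num.sqrt 2 * c) ^+ 2 by rewrite exprMn sqr_sqrtr.
  by rewrite ltrXn2r// ltW.
pose D := c ^+ 2 + 4 * V ^+ 2.
have D0 : 0 <= D by apply: addr_ge0; [exact: sqr_ge0|apply: mulr_ge0 => //; exact: sqr_ge0].
pose S := Num.sqrt D.
have S0 : 0 <= S by exact: sqrtr_ge0.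
have S2 : S ^+ 2 = c ^+ 2 + 4 * V ^+ 2 by rewrite /S sqr_sqrtr.
pose L := c * S - V ^+ 2 - c ^+ 2.
have L0 : 0 < L.
  suff : V ^+ 2 + c ^+ 2 < c * S by move=> H; rewrite /L -addrA -opprD subr_gt0.
  rewrite ltNge; apply/negP => le.
  have : (c * S) ^+ 2 <= (V ^+ 2 + c ^+ 2) ^+ 2.
    by rewrite lerXn2r ?nnegrE ?addr_ge0 ?sqr_ge0 ?mulr_ge0 ?(ltW c0).
  rewrite exprMn S2.
  have : V ^+ 2 * V ^+ 2 < 2 * c ^+ 2 * V ^+ 2 by rewrite ltr_pM2r ?exprn_gt0.
  rewrite sqrrD !expr2; lra.
pose lam := Num.sqrt L.
have lam2 : lam ^+ 2 = L by rewrite /lam sqr_sqrtr// ltW.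
have lam0 : 0 < lam by rewrite sqrtr_gt0.
pose K := lam ^+ 2 + V ^+ 2.
have K0 : 0 < K by rewrite addr_gt0 ?exprn_gt0.
have KE : K ^+ 2 = 2 * c ^+ 2 * (V ^+ 2 - lam ^+ 2).
  rewrite /K lam2 /L.
  have -> : c * S - V ^+ 2 - c ^+ 2 + V ^+ 2 = c * (S - c) by ring.
  have -> : V ^+ 2 - (c * S - V ^+ 2 - c ^+ 2) = 2 * V ^+ 2 + c ^+ 2 - c * S by ring.
  by rewrite exprMn sqrrB S2; ring.
have K0' : K != 0 by rewrite gt_eqF.
have Kp : K * (2 * lam * V / K) = 2 * lam * V by field.
have Kq : K * ((V ^+ 2 - lam ^+ 2) / K) = V ^+ 2 - lam ^+ 2 by field.
exists lam, K, (2 * lam * V / K), ((V ^+ 2 - lam ^+ 2) / K); split => //.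
- split; first by rewrite divr_gt0// !mulr_gt0.
  have -> : (2 * lam * V / K) ^+ 2 + ((V ^+ 2 - lam ^+ 2) / K) ^+ 2 =
    (lam ^+ 2 + V ^+ 2) ^+ 2 / K ^+ 2 by field.
  by rewrite divff// expf_neq0.
- apply: (mulfI K0'); rewrite -expr2 KE mulrC.
  by rewrite [in RHS]mulrCA [K * _]mulrCA Kq; ring.
Qed.

(** * The weight and the choice of the frequency *)

Section Profile.
Variable R : realType.
Implicit Types (l x d : R).

Definition profile d l x : R := d * ((x - l) * (l + 1 - x)) ^+ 2.

Lemma window_profile d l : window l (profile d l).
Proof.
exists (fun x => d * (2 * ((x - l) * (l + 1 - x)) * (2 * l + 1 - 2 * x))).
exists (fun x => d * (2 * ((2 * l + 1 - 2 * x) ^+ 2 - 2 * ((x - l) * (l + 1 - x))))); split.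
- by move=> x; rewrite /profile; apply: is_derive_eq; rewrite /GRing.scale /=; ring.
- by move=> x; apply: is_derive_eq; rewrite /GRing.scale /=; ring.
- by cont.
- by rewrite /profile !subrr mul0r mulr0 expr0n/= mulr0.
- by split; ring.
Qed.

Lemma window_xprofile d l : window l (fun x => x * profile d l x).
Proof.
have := @windowM R l (profile d l) (fun x => x) (fun=> 1) (fun=> 0) (window_profile d l).
under [in X in _ -> _ -> _ -> X]eq_fun do rewrite mulrC.
by apply; exact: cont_cst.
Qed.

Lemma profile_le d l x : 0 <= d -> l <= x <= l + 1 -> `|profile d l x| <= d.
Proof.
move=> d0 /andP[lx xl]; rewrite ger0_norm; last by apply: mulr_ge0 => //; exact: sqr_ge0.
have h0 : 0 <= (x - l) * (l + 1 - x) by rewrite mulr_ge0 ?subr_ge0.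
have h1 : (x - l) * (l + 1 - x) <= 1 by nra.
by rewrite ler_piMr// expr_le1.
Qed.

Lemma profile_ge d l x : 0 <= d -> l + 4^-1 <= x <= l + 2 * 4^-1 ->
  d * (2 ^- 6) <= `|profile d l x|.
Proof.
move=> d0 /andP[lx xl]; rewrite ger0_norm; last by apply: mulr_ge0 => //; exact: sqr_ge0.
rewrite ler_wpM2l// (_ : 2 ^- 6 = (4^-1 * 2^-1) ^+ 2); last by field.
have h0 : 0 <= 4^-1 * 2^-1 :> R by rewrite mulr_ge0 ?invr_ge0.
have h1 : 4^-1 * 2^-1 <= (x - l) * (l + 1 - x) by apply: ler_pM; lra.
by rewrite lerXn2r ?nnegrE// (le_trans h0).
Qed.

End Profile.

(** One term of the exponential series, of degree 2 m + 1, beats the polynomial,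
    which is at most (5 N^2)^m. *)
Lemma expR_dominates (R : realType) (r A : R) (m : nat) : 0 < r -> 0 <= A ->
  exists N : nat, (1 <= N)%N /\
    A * (1 + (N%:R + 1) ^+ 2) ^+ m <= expR (r * N%:R).
Proof.
move=> r0 A0.
pose B := A * 5 ^+ m * ((m.*2).+1)`!%:R / r ^+ (m.*2).+1.
have B0 : 0 <= B by rewrite /B; nonneg.
exists (Num.bound B).+1; split => //.
set N : R := (Num.bound B).+1%:R.
have N1 : 1 <= N by rewrite ler1n.
have N0 : 0 < N by exact: lt_le_trans N1.
have BN : B <= N.
  by rewrite (le_trans (ltW (archi_boundP B0)))// ler_nat.
have Q5 : 1 + (N + 1) ^+ 2 <= 5 * N ^+ 2 by nra.
have rN : 0 <= r * N by rewrite mulr_ge0// ltW.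
apply: (@le_trans _ _ ((r * N) ^+ (m.*2).+1 / ((m.*2).+1)`!%:R)); last first.
  by apply: le_trans (expR_ge1Dxn m.*2 rN); rewrite lerDr ler01.
apply: (@le_trans _ _ (A * (5 * N ^+ 2) ^+ m)).
  apply: ler_wpM2l => //; rewrite lerXn2r ?nnegrE//; by nonneg.
have f0 : 0 < ((m.*2).+1)`!%:R :> R by rewrite ltr0n fact_gt0.
have E1 : (5 * N ^+ 2) ^+ m = 5 ^+ m * N ^+ m.*2 by rewrite exprMn -exprM mul2n.
have E2 : (r * N) ^+ (m.*2).+1 = r ^+ (m.*2).+1 * (N * N ^+ m.*2).
  by rewrite exprMn [N ^+ _.+1]exprS.
rewrite ler_pdivlMr// E1 E2.
have -> : A * (5 ^+ m * N ^+ m.*2) * ((m.*2).+1)`!%:R = r ^+ (m.*2).+1 * (B * N ^+ m.*2).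
  by rewrite /B; field; rewrite ?expf_neq0 ?gt_eqF.
rewrite ler_pM2l ?exprn_gt0 //; apply: ler_wpM2r => //; nonneg.
Qed.

(** * Ill-posedness *)

Section Estimates.
Variables (R : realType) (l V lam p q K d : R) (j : nat).
Hypothesis l1 : 1 <= l.
Hypothesis lam0 : 0 < lam.
Hypothesis p0 : 0 < p.
Hypothesis pq1 : p ^+ 2 + q ^+ 2 = 1.
Hypothesis HK : K = lam ^+ 2 + V ^+ 2.
Hypothesis d0 : 0 <= d.

Let w := profile d l.
Let v x := x * w x.
Let U := solution l V lam p q w.
Let Q := 1 + (l + 1) ^+ 2.
Let l0 : 0 < l := lt_le_trans ltr01 l1.
Let lp0 : 0 <= l + 1. Proof. by nonneg. Qed.
Let K0 : 0 <= K. Proof. by rewrite HK; nonneg. Qed.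
Let Q1 : 1 <= Q. Proof. by rewrite /Q lerDl sqr_ge0. Qed.
Let Ql : l + 1 <= Q. Proof. by rewrite /Q; move: lp0 => ?; nra. Qed.

(** 4 q^2 and K are the squared moduli of the amplitudes of h and of v1, v2. *)
Definition energy_const (i : nat) : R := 2 * pi ^+ 2 * (1 + i.+1%:R * (4 * q ^+ 2 + K) / p).

Let B := energy_const j.

Let B_ge0 : 0 <= B.
Proof. by rewrite /B /energy_const; nonneg. Qed.

(** The exponent i + 2 of Q leaves room for the three factors l + 1 of the energy: two
    from the weight x w(x), one from the length of an interval that contains the
    frequencies. *)
Definition amplitude (i : nat) t : R :=
  Num.sqrt (energy_const i) * d * Q ^+ i.+2 * expR ((l + 1) * (lam * t)).

Lemma sqnorms_le t : 0 <= t ->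
  [/\ (sqnorm_Gamma j (uf U t) <= (amplitude j t ^+ 2)%:E)%E,
      (sqnorm_Omega j (fun s => uh U s t) <= (amplitude j t ^+ 2)%:E)%E,
      (sqnorm_Omega j (fun s => uv1 U s t) <= (amplitude j t ^+ 2)%:E)%E &
      (sqnorm_Omega j (fun s => uv2 U s t) <= (amplitude j t ^+ 2)%:E)%E].
Proof.
move=> t0.
have a0 : 0 <= lam * t by rewrite mulr_ge0// ltW.
have hw x : l <= x <= l + 1 -> `|w x| <= d by exact: profile_le.
have hv x : l <= x <= l + 1 -> `|v x| <= (l + 1) * d.
  move=> xl; rewrite normrM ler_pM ?hw//; move: xl => /andP[lx xl].
  by rewrite ger0_norm// (le_trans _ lx)// ltW.
have ww : window l w by exact: window_profile.
have wv : window l v by exact: window_xprofile.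
set e := expR (2 * ((l + 1) * (lam * t))).
have e0 : 0 <= e by exact: expR_ge0.
have ampE : amplitude j t ^+ 2 = B * (d ^+ 2 * Q ^+ j.+2 * e) * Q ^+ j.+2.
  rewrite /amplitude -/B /e expRM_natl -{2}(sqr_sqrtr B_ge0).
  by move: (Q ^+ j.+2) => Qj; ring.
have X0 : 0 <= d ^+ 2 * Q ^+ j.+2 * e.
  have : 0 <= Q by exact: le_trans Q1.
  by move=> ?; nonneg.
have up b : b <= B -> b * (d ^+ 2 * Q ^+ j.+2 * e) <= amplitude j t ^+ 2.
  move=> bB; rewrite ampE (@le_trans _ _ (B * (d ^+ 2 * Q ^+ j.+2 * e)))//.
    by rewrite ler_wpM2r.
  by rewrite ler_peMr ?exprn_ege1// mulr_ge0.
have Q0 : 0 <= Q by exact: le_trans Q1.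
have Ql2 : (l + 1) ^+ 2 <= Q by rewrite /Q lerDr.
have QE : Q ^+ j.+2 = Q ^+ j * (Q * Q) by rewrite !exprSr mulrA.
have Gam : front_bound l d 1 (lam * t) j <= amplitude j t ^+ 2.
  apply: le_trans (up (2 * pi ^+ 2) _); last first.
    rewrite /B /energy_const ler_peMr; by [nonneg|rewrite lerDl; nonneg].
  rewrite /front_bound -/Q -/e /sqmod/= expr1n expr0n/= addr0 mulr1.
  rewrite [leLHS](_ : _ = 2 * pi ^+ 2 * (d ^+ 2 * (Q ^+ j * (l + 1)) * e)); last by ring.
  apply: ler_wpM2l; first by nonneg.
  apply: ler_wpM2r => //; apply: ler_wpM2l; first exact: sqr_ge0.
  rewrite QE; apply: ler_wpM2l; first exact: exprn_ge0.
  by rewrite (le_trans Ql)// ler_peMr.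
have Om k : sqmod k <= 4 * q ^+ 2 + K ->
    half_bound l p ((l + 1) * d) k (lam * t) j + half_bound l p ((l + 1) * d) k (lam * t) j
     <= amplitude j t ^+ 2.
  move=> kq; apply: le_trans (up (2 * pi ^+ 2 * (j.+1%:R * sqmod k / p)) _); last first.
    rewrite /B /energy_const; apply: ler_wpM2l; first by nonneg.
    rewrite (@le_trans _ _ (j.+1%:R * (4 * q ^+ 2 + K) / p))//; last by rewrite lerDr.
    by rewrite ler_wpM2r ?invr_ge0 ?(ltW p0)// ler_wpM2l.
  rewrite /half_bound -/Q -/e.
  rewrite [leLHS](_ : _ = 2 * pi ^+ 2 * (j.+1%:R * sqmod k / p) *
    (d ^+ 2 * (Q ^+ j * ((l + 1) ^+ 2 * (l + 1))) * e)); last by field; rewrite gt_eqF.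
  apply: ler_wpM2l.
    by have := sqmod_ge0 k => ?; nonneg.
  apply: ler_wpM2r => //; apply: ler_wpM2l; first exact: sqr_ge0.
  rewrite QE; apply: ler_wpM2l; first exact: exprn_ge0.
  by apply: ler_pM => //; exact: sqr_ge0.
have Omega k : (forall s, sqmod (k s) <= 4 * q ^+ 2 + K) ->
    (forall s, sqmod (k s) = sqmod (k Plus)) ->
    (sqnorm_Omega j (fun s => mode l p q v (k s) s (lam * t)) <= (amplitude j t ^+ 2)%:E)%E.
  move=> kq kk; apply: (@le_trans _ _ (half_bound l p ((l + 1) * d) (k Plus) (lam * t) j
     + half_bound l p ((l + 1) * d) (k Plus) (lam * t) j)%:E); last first.
    by rewrite lee_fin Om.
  rewrite /sqnorm_Omega EFinD leeD//; first exact: sqnorm_half_mode_le.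
  rewrite [X in (_ <= X%:E)%E](_ : _ = half_bound l p ((l + 1) * d) (k Minus) (lam * t) j).
    exact: sqnorm_half_mode_le.
  by rewrite /half_bound kk.
split.
- apply: (@le_trans _ _ (front_bound l d 1 (lam * t) j)%:E); last by rewrite lee_fin.
  exact: sqnorm_Gamma_packet_le.
- apply: (Omega (fun=> (0 +i* (2 * q))%C)) => // s; rewrite /sqmod/=.
  by rewrite expr0n/= add0r exprMn -natrX lerDl.
- apply: (Omega (fun s => (lam +i* - (side_sign R s * V))%C)).
    by case; rewrite /sqmod/= HK; have := sqr_ge0 q; lra.
  by case; rewrite /sqmod/= ; ring.
- apply: (Omega (fun s => (lam +i* (side_sign R s * V))%C)).
    by case; rewrite /sqmod/= HK; have := sqr_ge0 q; lra.
  by case; rewrite /sqmod/= ; ring.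
Qed.

Lemma Hnorm_sol_le t : 0 <= t -> (Hnorm j U t <= (4 * amplitude j t)%:E)%E.
Proof.
move=> t0; have [h1 h2 h3 h4] := sqnorms_le t0.
have A0 : 0 <= amplitude j t.
  have : 0 <= Q by exact: le_trans Q1.
  by move=> ?; rewrite /amplitude; have := sqrtr_ge0 (energy_const j) => ?; nonneg.
have root (x : \bar R) (a : R) : 0 <= a -> (x <= (a ^+ 2)%:E)%E -> (sqrte x <= a%:E)%E.
  move=> a0 xa; rewrite (@le_trans _ _ (sqrte (a ^+ 2)%:E))//.
    by rewrite lee_sqrt// lee_fin sqr_ge0.
  by rewrite /= sqrtr_sqr ger0_norm.
have -> : 4 * amplitude j t = amplitude j t + amplitude j t + 2 * amplitude j t.
  by ring.
rewrite /Hnorm !EFinD; apply: leeD; first by apply: leeD; apply: root.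
apply: root; first by rewrite mulr_ge0.
apply: (@le_trans _ _ ((amplitude j t ^+ 2)%:E + (amplitude j t ^+ 2)%:E)%E).
  by apply: leeD; [exact: h3|exact: h4].
by rewrite -EFinD lee_fin; move: (amplitude j t) => Y; have := sqr_ge0 Y; rewrite !expr2; lra.
Qed.

Lemma in_H_sol t : 0 <= t -> in_H j U t.
Proof.
move=> t0; split.
- by apply: normable_packet; exact: window_profile.
- by move=> s; split; apply: normable_mode => //; exact: window_xprofile.
- exact: le_lt_trans (Hnorm_sol_le t0) (ltry _).
Qed.

(** The front alone suffices, through its frequencies in [l + 1/4, l + 1/2],
    where the weight is at least d / 64. *)
Lemma Hnorm_sol_ge i t : 0 <= t ->
  ((pi * d * 2 ^- 7 * expR (l * (lam * t)))%:E <= Hnorm i U t)%E.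
Proof.
move=> t0.
have a0 : 0 <= lam * t by rewrite mulr_ge0// ltW.
apply: (@le_trans _ _ (sqrte (sqnorm_Gamma i (uf U t)))); last first.
  by rewrite /Hnorm -addeA leeDl// adde_ge0// sqrte_ge0.
have x0 : 0 <= pi * d * 2 ^- 7 * expR (l * (lam * t)) by nonneg.
rewrite (_ : (pi * d * 2 ^- 7 * expR (l * (lam * t)))%:E =
  sqrte ((pi * d * 2 ^- 7 * expR (l * (lam * t))) ^+ 2)%:E); last first.
  by rewrite /= sqrtr_sqr ger0_norm.
have G := @sqnorm_Gamma_packet_ge R l l1 w (window_profile d l) 1 (lam * t) i (d * 2 ^- 6) 4^-1 a0.
rewrite lee_sqrt; last first.
  by apply: integral_ge0 => eta _; rewrite lee_fin; nonneg.
apply: le_trans (G _ _ _ _).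
- rewrite lee_fin /sqmod/= expr1n expr0n/= addr0 mulr1 expRM_natl.
  by rewrite le_eqVlt; apply/orP; left; apply/eqP; field.
- by rewrite invr_gt0.
- by nonneg.
- by move=> x xl; exact: profile_ge.
- lra.
Qed.

End Estimates.

Theorem lemma4p2 (R : realType) (c vbar eps0 : R)
  (hc : 0 < c) (hvbar : 0 < vbar) (heps0 : 0 < eps0)
  (hM_ge : eps0 <= vbar / c) (hM_lt : vbar / c < Num.sqrt 2)
  (k j : nat) (hkj : (k <= j)%N)
  (T0 alpha : R) (hT0 : 0 < T0) (halpha : 0 < alpha) :
  exists (C : R) (U : nat -> unknowns R),
    0 < C /\
    forall n : nat, (1 <= n)%N ->
      [/\ is_solution c vbar (U n),
          jump_conditions vbar (U n),
          (forall t : R, 0 <= t -> in_H j (U n) t),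
          (Hnorm j (U n) 0 <= (C / n%:R)%:E)%E &
          forall t : R, T0 <= t -> (alpha%:E <= Hnorm k (U n) t)%E].
Proof.
have [lam [K [p [q [lam0 [p0 pq1] HK [K0 Kp Kq] Kc]]]]] := dispersion_relation hc hvbar hM_lt.
pose Q (N : nat) : R := (1 + (N%:R + 1) ^+ 2) ^+ j.+2.
have Q0 N : 0 < Q N by rewrite exprn_gt0// ltr_pwDl// sqr_ge0.
have large (n : nat) : exists N : nat, (1 <= N)%N /\
    alpha * (2 ^+ 7 * n%:R / pi) * Q N <= expR (lam * T0 * N%:R).
  apply: expR_dominates; first exact: mulr_gt0.
  by have := pi_ge0 R => ?; nonneg.
have [N hN] := choice large.
(* With this size the bound of Hnorm_sol_le at time 0 is exactly C / n. *)
pose d n : R := (n%:R * Q (N n))^-1.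
pose U n := solution (N n)%:R vbar lam p q (profile (d n) (N n)%:R).
exists (4 * Num.sqrt (energy_const p q K j)), U; split.
  have K_ge0 : 0 <= K by rewrite HK; nonneg.
  rewrite mulr_gt0// sqrtr_gt0 /energy_const mulr_gt0//.
    by rewrite mulr_gt0// exprn_gt0// pi_gt0.
  by rewrite ltr_pwDl//; nonneg.
move=> n n1.
have [N1 NQ] := hN n.
have l1 : 1 <= (N n)%:R :> R by rewrite ler1n.
have n0 : 0 < n%:R :> R by rewrite ltr0n.
have d0 : 0 < d n by rewrite invr_gt0 mulr_gt0.
have cw : continuous (profile (d n) (N n)%:R) by exact/window_continuous/window_profile.
split.
- split; first exact: regular_sol.
    exact: (bulk_sol _ K0 HK Kp Kq Kc cw).
  exact: front_sol.
- exact: jump_sol.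
- by move=> t t0; exact: (in_H_sol j l1 lam0 p0 pq1 HK (ltW d0) t0).
- apply: le_trans (Hnorm_sol_le j l1 lam0 p0 pq1 HK (ltW d0) (lexx 0)) _.
  rewrite lee_fin /amplitude mulr0 mulr0 expR0 mulr1 -/(Q (N n)) /d.
  rewrite le_eqVlt; apply/orP; left; apply/eqP; field.
  by rewrite !gt_eqF.
- move=> t tT0; have t0 : 0 <= t by rewrite (le_trans _ tT0)// ltW.
  apply: le_trans (Hnorm_sol_ge vbar p q l1 lam0 (ltW d0) k t0); rewrite lee_fin.
  apply: (@le_trans _ _ (pi * d n * 2 ^- 7 * expR (lam * T0 * (N n)%:R))); last first.
    apply: ler_wpM2l; first by have := ltW d0 => ?; nonneg.
    rewrite ler_expR mulrC; apply: ler_wpM2l; first exact: ler0n.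
    by rewrite ler_pM2l.
  apply: le_trans (ler_wpM2l _ NQ); last by have := ltW d0 => ?; nonneg.
  rewrite le_eqVlt; apply/orP; left; apply/eqP; rewrite /d.
  by move: (pi_gt0 R) => /gt_eqF; move: pi => P hP; field; rewrite hP (gt_eqF n0) gt_eqF.
Qed.
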